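(* Let $\mathbb{k}$ be an algebraically closed field, let $N\geq2$ be an integer, and let $A$ and $B$ be finite dimensional graded associative $\mathbb{k}$-algebras with unit such that $B$ is a graded degeneration of $A$. If $B$ is $N$-Koszul, then $A$ is $N$-Koszul.
   Context: Graded degeneration: for a finite dimensional graded vector space $V=\bigoplus_{i\in\mathbb{Z}}V_i$ over $\mathbb{k}$, $\mathsf{GrAss}_{\mathbb{k}}(V)$ is the affine variety of graded associative algebra structures on $V$, i.e. of associative products $\varphi:V\otimes V\to V$ with $\varphi(V_i\otimes V_j)\subseteq V_{i+j}$. The algebraic group $\operatorname{GL}_0(V)$ of linear automorphisms of $V$ of degree $0$ acts on it by $g\cdot\varphi=g\circ\varphi\circ(g^{-1}\otimes g^{-1})$; orbits correspond to isomorphism classes of finite dimensional graded algebras with the same Hilbert series as $V$. For graded algebras $A,B$ regarded as points of $\mathsf{GrAss}_{\mathbb{k}}(V)$, with orbits $\mathcal{O}_A,\mathcal{O}_B$, $B$ is a graded degeneration of $A$ if $\mathcal{O}_B\subseteq\overline{\mathcal{O}_A}$ (Zariski closure in $\mathsf{GrAss}_{\mathbb{k}}(V)$). $N$-Koszul: let $A=\bigoplus_iA_i$ be a finite dimensional graded $\mathbb{k}$-algebra with unit, generated as an algebra by $A_1$; in particular $A_0=\mathbb{k}$ and $J=\bigoplus_{i\geq1}A_i$ is a maximal ideal, and $\mathbb{k}$ is regarded as an $A$-module by identifying it with $A/J$. Define $n:\mathbb{N}\to\mathbb{N}$ (with $0\in\mathbb{N}$) by $n(2i)=iN$ and $n(2i+1)=iN+1$.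 The grading of $A$ induces a grading on $\operatorname{Tor}^A_i(\mathbb{k},\mathbb{k})$ for all $i$, whose homogeneous component of degree $j$ is denoted $\operatorname{Tor}^A_{ij}(\mathbb{k},\mathbb{k})$. The algebra $A$ is $N$-Koszul if $\operatorname{Tor}^A_{ij}(\mathbb{k},\mathbb{k})=0$ for all $i,j\geq0$ such that $j\neq n(i)$. Being generated by $A_1$ is part of the notion of $N$-Koszul algebra: it is assumed for $B$ as part of $N$-Koszulness and is part of the conclusion for $A$. *)

(* Defs.v *)
From HB Require Import structures.
From mathcomp Require Import all_boot all_order all_algebra.
From mathcomp Require Import mpoly.
Set Implicit Arguments.
Unset Strict Implicit.
Unset Printing Implicit Defensive.
Import Order.TTheory GRing.Theory Num.Theory.
Local Open Scope ring_scope.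

Record grading (k : fieldType) (V : vectType k) := Grading {
  gcomp :> int -> {vspace V};
  gsupp : seq int;
  gsupp_uniq : uniq gsupp;
  gsuppP : forall i, i \notin gsupp -> gcomp i = 0%VS;
  gdirect : directv (\sum_(i <- gsupp) gcomp i)%VS;
  gfull : (\sum_(i <- gsupp) gcomp i)%VS = fullv }.

(* Linear maps V (x) V -> V, in curried form. *)
Notation prodOn V := 'Hom(V, 'Hom(V, V)).

Definition grAss (k : fieldType) (V : vectType k) (G : grading V)
    (m : prodOn V) : Prop :=
  (forall x y z, m (m x y) z = m x (m y z)) /\
  (forall i j x y, x \in G i -> y \in G j -> m x y \in G (i + j)).

Definition polyval (k : fieldType) (W : vectType k)
    (p : {mpoly k[\dim {:W}]}) (w : W) : k :=
  p.@[fun i => coord (vbasis {:W}) i w].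

Definition grAss_closed (k : fieldType) (V : vectType k) (G : grading V)
    (Z : prodOn V -> Prop) : Prop :=
  exists I : {mpoly k[\dim {:prodOn V}]} -> Prop,
    forall m, Z m <-> grAss G m /\ (forall p, I p -> polyval p m = 0).

Definition grAss_closure (k : fieldType) (V : vectType k) (G : grading V)
    (S : prodOn V -> Prop) (m : prodOn V) : Prop :=
  forall Z, grAss_closed G Z -> (forall m', S m' -> Z m') -> Z m.

Definition GL0 (k : fieldType) (V : vectType k) (G : grading V)
    (g : 'End(V)) : Prop :=
  lker g = 0%VS /\ (forall i, (g @: G i <= G i)%VS).

Definition gorbit (k : fieldType) (V : vectType k) (G : grading V)
    (m m' : prodOn V) : Prop :=
  exists2 g : 'End(V), GL0 G g &
    forall x y, m' x y = g (m (g^-1%VF x) (g^-1%VF y)).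

Record gralg (k : fieldType) (V : vectType k) (G : grading V) := GrAlg {
  gmul : prodOn V;
  gone : V;
  gmulP : grAss G gmul;
  gmul1x : forall x, gmul gone x = x;
  gmulx1 : forall x, gmul x gone = x }.

Definition graded_degeneration (k : fieldType) (V : vectType k)
    (G : grading V) (A B : gralg G) : Prop :=
  forall m, gorbit G (gmul B) m -> grAss_closure G (gorbit G (gmul A)) m.

Definition generated_in_degree1 (k : fieldType) (V : vectType k)
    (G : grading V) (A : gralg G) : Prop :=
  forall U : {vspace V}, gone A \in U -> (G 1 <= U)%VS ->
    (forall x y, x \in U -> y \in U -> gmul A x y \in U) -> U = fullv.

(* The axioms are kept apart in [is_grmod], so that the module k below can be
   written down for every A, although it satisfies them only if A_0 = k. *)
Record grmod (k : fieldType) (V : vectType k) := GrMod {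
  mcar :> vectType k;
  mgr : grading mcar;
  mact : 'Hom(V, 'End(mcar)) }.

Definition is_grmod (k : fieldType) (V : vectType k) (G : grading V)
    (A : gralg G) (M : grmod V) : Prop :=
  [/\ forall x : M, mact M (gone A) x = x,
      forall a b (x : M), mact M (gmul A a b) x = mact M a (mact M b x) &
      forall i j a (x : M),
        a \in G i -> x \in mgr M j -> mact M a x \in mgr M (i + j)].

Definition is_grhom (k : fieldType) (V : vectType k) (M N : grmod V)
    (f : 'Hom(M, N)) : Prop :=
  (forall a x, f (mact M a x) = mact N a (f x)) /\
  (forall i, (f @: mgr M i <= mgr N i)%VS).

Definition is_grproj (k : fieldType) (V : vectType k) (G : grading V)
    (A : gralg G) (P : grmod V) : Prop :=
  is_grmod A P /\
  forall (M N : grmod V) (g : 'Hom(M, N)) (f : 'Hom(P, N)),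
    is_grmod A M -> is_grmod A N -> is_grhom g -> is_grhom f ->
    limg g = fullv ->
    exists2 h : 'Hom(P, M), is_grhom h & (g \o h)%VF = f.

Definition augideal (k : fieldType) (V : vectType k) (G : grading V) :
    {vspace V} :=
  (\sum_(i <- gsupp G | (1 <= i)%R) G i)%VS.

(* The map A -> A/J = k: the coordinate on 1 of the projection onto k.1
   along J. *)
Definition augm (k : fieldType) (V : vectType k) (G : grading V)
    (A : gralg G) (a : V) : k :=
  coord [tuple gone A] ord0 (daddv_pi <[gone A]> (augideal G) a).

Definition deg0_comp (k : fieldType) (i : int) : {vspace k^o} :=
  if i == 0 then fullv else 0%VS.

Lemma deg0_direct (k : fieldType) :
  directv (\sum_(i <- [:: 0%R]) deg0_comp k i)%VS.
Proof. by rewrite directvE /= !big_seq1. Qed.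

Lemma deg0_supp (k : fieldType) (i : int) :
  i \notin [:: 0%R] -> deg0_comp k i = 0%VS.
Proof. by rewrite inE /deg0_comp => /negPf->. Qed.

Lemma deg0_full (k : fieldType) :
  (\sum_(i <- [:: 0%R]) deg0_comp k i)%VS = fullv.
Proof. by rewrite big_seq1. Qed.

Definition deg0_grading (k : fieldType) : grading k^o :=
  @Grading k k^o (deg0_comp k) [:: 0%R] isT (@deg0_supp k)
    (deg0_direct k) (deg0_full k).

Definition trivmod (k : fieldType) (V : vectType k) (G : grading V)
    (A : gralg G) : grmod V :=
  GrMod (deg0_grading k) (linfun (fun a : V => augm A a *: \1%VF)).

Record grres (k : fieldType) (V : vectType k) := GrRes {
  rmod : nat -> grmod V;
  rdiff : forall n, 'Hom(rmod n.+1, rmod n);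
  raug : 'Hom(rmod 0%N, k^o) }.

Definition is_projres (k : fieldType) (V : vectType k) (G : grading V)
    (A : gralg G) (P : grres V) : Prop :=
  [/\ forall n, is_grproj A (rmod P n),
      forall n, is_grhom (rdiff P n) &
      is_grhom (raug P : 'Hom(rmod P 0%N, trivmod A))] /\
  [/\ limg (raug P) = fullv,
      limg (rdiff P 0%N) = lker (raug P) &
      forall n, limg (rdiff P n.+1) = lker (rdiff P n)].

(* As k (x)_k M = M, the tensor product k (x)_A M is the quotient of M by the
   span of the elements eps(a) x - a x, where eps is the augmentation; by
   linearity it is enough to let a run through a basis of A. *)
Definition tens_rel (k : fieldType) (V : vectType k) (G : grading V)
    (A : gralg G) (M : grmod V) : {vspace M} :=
  (\sum_(a <- vbasis {:V}) limg (augm A a *: \1%VF - mact M a))%VS.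

(* [tor_cycles] and [tor_bounds] are the preimages in P_i of the cycles and of
   the boundaries of the complex k (x)_A P. *)
Definition tor_cycles (k : fieldType) (V : vectType k) (G : grading V)
    (A : gralg G) (P : grres V) (i : nat) : {vspace rmod P i} :=
  if i is i'.+1 then (rdiff P i' @^-1: tens_rel A (rmod P i'))%VS else fullv.

Definition tor_bounds (k : fieldType) (V : vectType k) (G : grading V)
    (A : gralg G) (P : grres V) (i : nat) : {vspace rmod P i} :=
  (limg (rdiff P i) + tens_rel A (rmod P i))%VS.

(* Tor_ij(k, k) = 0. All modules here are finite dimensional over k; as A is,
   k has resolutions by finite dimensional graded projective modules, and
   Tor does not depend on the resolution. *)
Definition tor_eq0 (k : fieldType) (V : vectType k) (G : grading V)
    (A : gralg G) (i : nat) (j : int) : Prop :=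
  exists2 P : grres V, is_projres A P &
    (tor_cycles A P i :&: mgr (rmod P i) j <= tor_bounds A P i)%VS.

Definition koszul_deg (N i : nat) : nat := (i./2 * N + odd i)%N.

(* 1 != 0 excludes the zero algebra, for which A_0 = k fails. *)
Definition koszul (k : fieldType) (N : nat) (V : vectType k) (G : grading V)
    (A : gralg G) : Prop :=
  [/\ gone A != 0,
      generated_in_degree1 A &
      forall i j : nat, j <> koszul_deg N i -> tor_eq0 A i j%:Z].

(* Main.v *)
Require Import Defs.
From HB Require Import structures.
From mathcomp Require Import all_boot all_order all_algebra.
From mathcomp Require Import mpoly.
Set Implicit Arguments.
Unset Strict Implicit.
Unset Printing Implicit Defensive.
Import Order.TTheory GRing.Theory Num.Theory.
Local Open Scope ring_scope.

(** For an algebra A with A_0 = k and augmentation ideal J, Tor^A_n(k, k) is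
    the homology of the normalised bar complex, whose n-th term is the n-fold
    tensor power of J. As a graded space this term depends only on the Hilbert
    series, and its differential is polynomial in the structure constants of
    the product. Exactness of a complex of fixed finite dimensional spaces, at
    one place and in one degree, is an open condition on the differentials: it
    is implied by the non-vanishing of one polynomial, which can be chosen not
    to vanish at a given exact complex ([exactness_open]). If B lies in the
    closure of the orbit of A and Tor_nj vanishes for B, then this polynomial is
    not zero at B, hence not zero on the whole orbit of A
    ([degeneration_polyfun]), and so the bar complex of some algebra in that
    orbit is exact there. The structure constants of g.A in a basis s are those
    of A in the basis g^-1(s) ([transport_struct_const]), so it is Tor_nj of A
    itself that vanishes.

    The bar complex is obtained by iterating syzygies. For a graded module M
    the kernel of the multiplication map from A (x) M to M is a copy of
    J (x) M with a twisted action ([syz]); starting from k, the n-th iterate is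
    carried by the n-th tensor power of J, and the free modules
    A (x) J^(x)n form a projective resolution of k ([bar_projres]).
    Applying k (x)_A - to it leaves the maps J (x) M -> M given by the
    action ([free_red_rdiff]).

    Vanishing of Tor_nj means here that some projective resolution has no
    homology after tensoring, and the resolution may vary with n and j. The
    usual comparison of resolutions ([tor_independent]) shows that the bar
    resolution can always be taken ([tor_eq0_bar]).

    Finally, B generated in degree 1 forces the 0-th component of the grading
    to be a line, a property of the grading alone that A inherits, and A is
    generated in degree 1 because Tor_1j = 0 for j <> 1 says that J is
    contained in A_1 + J.J ([generated_of_bar_exact]). *)

(** * Gradings *)

Lemma linfun_linearE (k : fieldType) (U W : vectType k) (f : U -> W) :
  linear f -> linfun f =1 f.
Proof.
move=> lf; pose fL := GRing.isLinear.Build _ _ _ _ f lf.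
pose F : {linear U -> W} := HB.pack f fL.
exact: (lfunE F).
Qed.

Section Projections.
Variables (k : fieldType) (U : vectType k) (H : grading U).

Definition gproj (i : int) : 'End(U) :=
  if i \in gsupp H then sumv_pi_for (esym (gfull H)) i else 0.

Lemma gproj_mem i u : gproj i u \in H i.
Proof.
rewrite /gproj; case: ifP => _; first exact: memv_sum_pi.
by rewrite lfunE mem0v.
Qed.

Lemma gproj_sum u : \sum_(i <- gsupp H) gproj i u = u.
Proof.
rewrite -[RHS](sumv_pi_uniq_sum (esym (gfull H))) ?memvf //; last first.
  by rewrite filter_predT gsupp_uniq.
by rewrite !big_seq; apply: eq_bigr => i si; rewrite /gproj si.
Qed.

Lemma grading_eq0 (u : int -> U) :
  (forall i, u i \in H i) -> \sum_(i <- gsupp H) u i = 0 -> forall i, u i = 0.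
Proof.
move=> uH su0 i; have [si | /gsuppP Hi0] := boolP (i \in gsupp H); last first.
  by have := uH i; rewrite Hi0 memv0 => /eqP.
have := gdirect H; rewrite directvE /= !(big_tnth _ _ (gsupp H)) -directvE /=.
move/(@directv_sum_independent _ _ _ predT (fun j => H (tnth (in_tuple (gsupp H)) j))).
move/(_ (fun j => u (tnth (in_tuple (gsupp H)) j)) (fun j _ => uH _)).
rewrite -(big_tnth _ _ (gsupp H) predT) su0 => /(_ erefl).
by move=> h; case/(tnthP (in_tuple (gsupp H))): si => j ->; apply: h.
Qed.

(** The differences between the two sides, for all [j], form a family of
    homogeneous elements with sum 0, and such a family vanishes. *)
Lemma gproj_same_out i u : u \in H i ->
  forall j, gproj j u = if j == i then u else 0.
Proof.
move=> ui; pose w j := gproj j u - (if j == i then u else 0).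
have Hw j : w j \in H j.
  by rewrite memvB ?gproj_mem //; case: eqP => [->|]; rewrite ?mem0v.
suff sw : \sum_(j <- gsupp H) w j = 0.
  by move=> j; apply/eqP; rewrite -subr_eq0; apply/eqP/(grading_eq0 Hw sw).
rewrite sumrB gproj_sum; have [si | nsi] := boolP (i \in gsupp H).
  rewrite (bigD1_seq i) ?gsupp_uniq //= eqxx big1 ?addr0 ?subrr //.
  by move=> j /negPf ->.
move: ui; rewrite (gsuppP nsi) memv0 => /eqP ->.
by rewrite big1 ?subrr // => j _; rewrite if_same.
Qed.

Lemma gproj_id i u : u \in H i -> gproj i u = u.
Proof. by move/gproj_same_out->; rewrite eqxx. Qed.

Lemma gproj_out i j u : u \in H i -> j != i -> gproj j u = 0.
Proof. by move/gproj_same_out-> => /negPf->. Qed.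

Lemma gprojK i u : gproj i (gproj i u) = gproj i u.
Proof. by rewrite gproj_id ?gproj_mem. Qed.

End Projections.

Section GradedMaps.
Variables (k : fieldType) (U W : vectType k) (H : grading U) (K : grading W).
Implicit Types f : 'Hom(U, W).

Definition graded_map f := forall i, (f @: H i <= K i)%VS.

Lemma graded_mapP f :
  graded_map f <-> forall i u, u \in H i -> f u \in K i.
Proof.
split=> [gf i u ui | gf i]; first by apply: (subvP (gf i)); apply: memv_img.
by apply/subvP => _ /memv_imgP[u ui ->]; apply: gf.
Qed.

Lemma graded_gproj f : graded_map f ->
  forall i u, f (gproj H i u) = gproj K i (f u).
Proof.
move/graded_mapP => gf i u; rewrite -{2}[u](gproj_sum H) !linear_sum /=.
have [si | nsi] := boolP (i \in gsupp H).
  rewrite (bigD1_seq i) ?gsupp_uniq //= (gproj_id (H := K)) ?gf ?gproj_mem //.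
  rewrite big1 ?addr0 // => j ji.
  by rewrite (@gproj_out _ _ _ j) // 1?eq_sym // gf ?gproj_mem.
rewrite /gproj (negPf nsi) lfunE linear0 big1_seq // => j /andP[_ sj].
rewrite -/(gproj K i) -/(gproj H j) (@gproj_out _ _ _ j) //.
  by rewrite gf ?gproj_mem.
by apply: contraNneq nsi => ->.
Qed.

(** The inverse [f^-1] of a linear map need not preserve degrees, even if [f]
    does; projecting before and after it repairs this without losing the section
    property, because the image of a graded map is a graded subspace. *)
Definition graded_section f : 'Hom(W, U) :=
  (\sum_(i <- gsupp K) (gproj H i \o f^-1 \o gproj K i))%VF.

Lemma graded_section_mem f i w : w \in K i -> graded_section f w \in H i.
Proof.
move=> wi; rewrite sum_lfunE memv_suml // => j _; rewrite !comp_lfunE.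
have [-> | ji] := eqVneq j i; first exact: gproj_mem.
by rewrite (gproj_out wi ji) !linear0 mem0v.
Qed.

Lemma graded_sectionK f : graded_map f ->
  forall w, w \in limg f -> f (graded_section f w) = w.
Proof.
move=> gf w wf; rewrite sum_lfunE linear_sum -[RHS](gproj_sum K) /=.
apply: eq_bigr => i _; rewrite !comp_lfunE (graded_gproj gf) limg_lfunVK ?gprojK //.
by case/memv_imgP: wf => u _ ->; rewrite -(graded_gproj gf) memv_img ?memvf.
Qed.

End GradedMaps.

Section MakeGrading.
Variables (k : fieldType) (U : vectType k) (C : int -> {vspace U}).
Variables (pi : int -> U -> U) (s : seq int).
Hypothesis pi_lin : forall i, linear (pi i).
Hypothesis pi_id : forall i u, u \in C i -> pi i u = u.
Hypothesis pi_out : forall i j u, u \in C j -> i != j -> pi i u = 0.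

(** Projections separating the components give a direct sum without any
    computation of dimensions. *)
Lemma directv_projections : uniq s -> directv (\sum_(i <- s) C i)%VS.
Proof.
rewrite directvE /=; elim: s => [|i r IHr] /=; first by rewrite !big_nil dimv0.
case/andP=> nir ur; rewrite !big_cons dimv_disjoint_sum ?(eqP (IHr ur)) //.
apply/eqP; rewrite -subv0; apply/subvP => u /memv_capP[ui].
rewrite memv0 -[u in u == 0](pi_id ui) => ur'.
have {ur'} : (pi i u = 0).
  move: ur'; rewrite big_tnth => /memv_sumP[v vC ->].
  rewrite -(linfun_linearE (pi_lin i)) linear_sum big1 //= => j _.
  rewrite (linfun_linearE (pi_lin i)) (pi_out (vC j isT)) //.
  by apply: contraNneq nir => ->; apply: mem_tnth.
by move->.
Qed.

End MakeGrading.

Section FfunGrading.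
Variables (k : fieldType) (W : vectType k) (H : grading W).
Variables (I : finType) (dg : I -> int).
Local Notation F := {ffun I -> W}.

Definition delta_ffun (i : I) (w : W) : F := [ffun j => if j == i then w else 0].

Lemma ffun_delta_sum (f : F) : f = \sum_i delta_ffun i (f i).
Proof.
apply/ffunP => j; rewrite sum_ffunE (bigD1 j) //= ffunE eqxx big1 ?addr0 //.
by move=> i; rewrite ffunE eq_sym => /negPf->.
Qed.

Lemma delta_ffun_linear i : linear (delta_ffun i).
Proof.
move=> a u v; apply/ffunP => j; rewrite !ffunE; case: ifP => // _.
by rewrite scaler0 addr0.
Qed.

Lemma ev_linear (i : I) : linear (fun f : F => f i).
Proof. by move=> a f g; rewrite !ffunE. Qed.

(** [{ffun I -> W}] stands for the tensor product with [W] of a space with a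
    homogeneous basis indexed by [I], the basis element of index [i] having
    degree [dg i]. *)
Definition ffun_comp (n : int) : {vspace F} :=
  (\bigcap_i (linfun (fun f : F => f i) @^-1: H (n - dg i)))%VS.

Lemma ffun_compP n (f : F) :
  reflect (forall i, f i \in H (n - dg i)) (f \in ffun_comp n).
Proof.
have E i : (f \in linfun (fun f : F => f i) @^-1: H (n - dg i))%VS
    = (f i \in H (n - dg i)).
  by rewrite -memv_preim (linfun_linearE (ev_linear i)).
rewrite memvE; apply: (iffP subv_bigcapP) => [h i | h i _].
  by rewrite -E memvE h.
by rewrite -memvE E.
Qed.

Definition ffun_proj (n : int) (f : F) : F :=
  [ffun i => gproj H (n - dg i) (f i)].

Definition ffun_supp : seq int :=
  undup [seq dg i + j | i <- enum I, j <- gsupp H].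

Lemma ffun_supp_out n : n \notin ffun_supp -> ffun_comp n = 0%VS.
Proof.
move=> nn; apply/eqP; rewrite -subv0; apply/subvP => f /ffun_compP fn.
rewrite memv0; apply/eqP/ffunP => i; rewrite ffunE.
have [si|nsi] := boolP (n - dg i \in gsupp H); last first.
  by have := fn i; rewrite gsuppP // memv0 => /eqP.
case/negP: nn; rewrite mem_undup; apply/allpairsP.
by exists (i, n - dg i); rewrite mem_enum /= si addrC subrK.
Qed.

Lemma ffun_direct : directv (\sum_(n <- ffun_supp) ffun_comp n)%VS.
Proof.
apply: (directv_projections (pi := ffun_proj)); last exact: undup_uniq.
- by move=> n a f g; apply/ffunP => i; rewrite !ffunE linearP.
- by move=> n f /ffun_compP fn; apply/ffunP => i; rewrite ffunE gproj_id.
- move=> n m f /ffun_compP fm nm; apply/ffunP => i; rewrite !ffunE.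
  by apply: gproj_out (fm i) _; apply: contraNneq nm => /addIr->.
Qed.

Lemma sumv_seq_sup (T : vectType k) (C : int -> {vspace T}) (s : seq int) i :
  i \in s -> (C i <= \sum_(j <- s) C j)%VS.
Proof. by move=> si; rewrite (big_rem i) //= addvSl. Qed.

Lemma ffun_full : (\sum_(n <- ffun_supp) ffun_comp n)%VS = fullv.
Proof.
apply/eqP; rewrite eqEsubv subvf /=; apply/subvP => f _.
rewrite [f]ffun_delta_sum memv_suml // => i _.
rewrite -[f i](gproj_sum H) -(linfun_linearE (delta_ffun_linear i)) linear_sum /=.
rewrite big_seq memv_suml // => j sj.
suff /sumv_seq_sup/subvP : dg i + j \in ffun_supp.
  apply; rewrite (linfun_linearE (delta_ffun_linear i)); apply/ffun_compP => i'.
  rewrite ffunE; case: eqP => [->|_]; last exact: mem0v.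
  by rewrite addrC addKr gproj_mem.
rewrite mem_undup; apply/allpairsP; exists (i, j).
by rewrite mem_enum.
Qed.

Definition ffun_grading : grading F :=
  Grading (undup_uniq _) ffun_supp_out ffun_direct ffun_full.

End FfunGrading.

(** * Algebras with an adapted basis *)

Section Units.
Variables (k : fieldType) (V : vectType k) (G : grading V) (A : gralg G).

Lemma gmulA x y z : gmul A (gmul A x y) z = gmul A x (gmul A y z).
Proof. by have [] := gmulP A. Qed.

Lemma gmul_homog i j x y : x \in G i -> y \in G j -> gmul A x y \in G (i + j).
Proof. by have [_] := gmulP A; apply. Qed.

(** The degree 0 part of the unit acts as the identity on homogeneous elements,
    hence everywhere, so it is the unit. *)
Lemma gone_homog : gone A \in G 0.
Proof.
pose e := gproj G 0 (gone A).
have he j x : x \in G j -> gmul A e x = x.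
  move=> xj; rewrite -{2}(gproj_id xj) -[x in RHS](gmul1x A).
  rewrite -(gproj_sum G (gone A)) linear_sum sum_lfunE linear_sum /=.
  have out i : i != 0 -> gproj G j (gmul A (gproj G i (gone A)) x) = 0.
    move=> i0; apply: gproj_out (gmul_homog (gproj_mem _ _ _) xj) _.
    by rewrite eq_sym -subr_eq0 addrK.
  have ej : gproj G j (gmul A e x) = gmul A e x.
    by rewrite gproj_id // -[j]add0r gmul_homog ?gproj_mem.
  have [s0 | ns0] := boolP (0 \in gsupp G).
    rewrite (bigD1_seq 0) ?gsupp_uniq //= ej big1 ?addr0 //.
  have e0 : e = 0 by rewrite /e /gproj (negPf ns0) lfunE.
  rewrite e0 linear0 lfunE big1_seq // => i /andP[_ si]; apply: out.
  by apply: contraNneq ns0 => <-.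
suff -> : gone A = e by apply: gproj_mem.
rewrite -[RHS](gmulx1 A) -[gone A in RHS](gproj_sum G) linear_sum /=.
rewrite -{1}(gproj_sum G (gone A)); apply: eq_bigr => j _.
by rewrite (he j) ?gproj_mem.
Qed.

End Units.

(** Such a basis starts with the unit and continues with a homogeneous basis of
    the augmentation ideal; it exists exactly when the algebra is connected, and
    identifies the augmentation with the coordinate of index 0. *)
Record adapted_basis (k : fieldType) (V : vectType k) (G : grading V)
    (A : gralg G) (d : nat) (X : d.+1.-tuple V) (dg : 'I_d.+1 -> int) : Prop :=
  AdaptedBasis {
    adb_basis : basis_of fullv X;
    adb_one : tnth X ord0 = gone A;
    adb_homog : forall b, tnth X b \in G (dg b);
    adb_pos : forall b, 1 <= dg (lift ord0 b) }.

Section Adapted.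
Variables (k : fieldType) (V : vectType k) (G : grading V) (A : gralg G).
Variables (d : nat) (X : d.+1.-tuple V) (dg : 'I_d.+1 -> int).
Hypothesis adX : adapted_basis A X dg.
Local Notation x_ b := (tnth X b).

Let freeX : free X.
Proof. by have /andP[] := adb_basis adX. Qed.

Lemma coord_adapted v : v = \sum_b coord X b v *: x_ b.
Proof.
rewrite {1}(coord_basis (adb_basis adX) (memvf v)).
by apply: eq_bigr => b _; rewrite (tnth_nth 0).
Qed.

Lemma coord_adapted_elt b c : coord X c (x_ b) = (b == c)%:R.
Proof. by rewrite (tnth_nth 0) (coord_free _ _ freeX). Qed.

Lemma coord_adapted_sum (f : 'I_d.+1 -> k) c :
  coord X c (\sum_b f b *: x_ b) = f c.
Proof.
rewrite linear_sum (bigD1 c) //= linearZ /= coord_adapted_elt eqxx mulr1.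
rewrite big1 ?addr0 // => b bc; rewrite linearZ /= coord_adapted_elt.
by rewrite (negPf bc) mulr0.
Qed.

(** The part of [v] spanned by the basis elements of degree [dg c] is the
    component of [v] of that degree, which is 0. *)
Lemma coord_homog n v c : v \in G n -> n != dg c -> coord X c v = 0.
Proof.
move=> vn nc; pose w i := \sum_(b | dg b == i) coord X b v *: x_ b.
have wG i : w i \in G i.
  by rewrite memv_suml // => b /eqP <-; rewrite memvZ ?(adb_homog adX).
have x0 b : x_ b != 0 by exact: (free_not0 freeX (mem_tnth _ _)).
have sb b : dg b \in gsupp G.
  apply: contraT => /gsuppP Hb; have := adb_homog adX b; rewrite Hb memv0.
  by rewrite (negPf (x0 b)).
have sw : v = \sum_(i <- gsupp G) w i.
  rewrite {1}[v]coord_adapted /w.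
  rewrite (exchange_big_dep predT) //=; apply: eq_bigr => b _.
  under eq_bigl => i do rewrite eq_sym.
  by rewrite -big_filter filter_pred1_uniq ?gsupp_uniq // big_seq1.
have wc0 : w (dg c) = 0.
  have := congr1 (gproj G (dg c)) sw.
  rewrite (gproj_out vn) 1?eq_sym // linear_sum (bigD1_seq (dg c)) ?gsupp_uniq ?sb //.
  rewrite /= [X in _ + X]big1 => [|i ic]; first by rewrite addr0 gproj_id.
  by rewrite (gproj_out (wG i)) // eq_sym.
have -> : coord X c v = coord X c (w (dg c)); last by rewrite wc0 linear0.
rewrite /w big_mkcond.
have E b : (if dg b == dg c then coord X b v *: x_ b else 0)
    = (if dg b == dg c then coord X b v else 0) *: x_ b.
  by case: ifP; rewrite ?scale0r.
rewrite (eq_bigr _ (fun b _ => E b)) {E}.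
by rewrite coord_adapted_sum eqxx.
Qed.

Lemma adb_deg0 : dg ord0 = 0.
Proof.
have x0 : x_ ord0 != 0 by exact: (free_not0 freeX (mem_tnth _ _)).
apply/eqP; rewrite eq_sym; apply: contraNT x0 => h.
have /= := @coord_homog 0 (x_ ord0) ord0.
rewrite coord_adapted_elt eqxx (adb_one adX) gone_homog => /(_ isT h).
by move/eqP; rewrite oner_eq0.
Qed.

Lemma adb_deg_gt0 b : b != ord0 -> 1 <= dg b.
Proof. by case: (unliftP ord0 b) => [c ->|->]; rewrite ?eqxx ?(adb_pos adX). Qed.

Lemma augm_linear : linear (augm A : V -> k^o).
Proof. by move=> a u v; rewrite /augm !linearP. Qed.

Lemma augideal_disjoint : (<[gone A]> :&: augideal G = 0)%VS.
Proof.
apply/eqP; rewrite -subv0; apply/subvP => v /memv_capP[v1 vJ].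
have v0 : v \in G 0.
  by case/vlineP: v1 => c ->; rewrite memvZ ?gone_homog.
rewrite memv0 -(gproj_id v0).
move: vJ; rewrite /augideal -big_filter big_tnth => /memv_sumP[w wG ->].
rewrite linear_sum big1 //= => i _; apply: gproj_out (wG i isT) _.
have := mem_tnth i (in_tuple [seq j <- gsupp G | 1 <= j]).
by rewrite mem_filter => /andP[i1 _]; apply: contraTneq i1 => <-.
Qed.

Lemma augideal_sup i v : 1 <= i -> v \in G i -> v \in augideal G.
Proof.
move=> i1 vi; have [si|/gsuppP Gi] := boolP (i \in gsupp G); last first.
  by move: vi; rewrite Gi memv0 => /eqP ->; rewrite mem0v.
have /subvP -> // : (G i <= augideal G)%VS.
by rewrite /augideal (big_rem i) //= i1 addvSl.
Qed.

(** Both sides are linear, so it is enough to compare them on the basis, where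
    the elements of positive degree lie in the augmentation ideal. *)
Lemma augmE v : augm A v = coord X ord0 v.
Proof.
have one0 : gone A != 0.
  by rewrite -(adb_one adX); exact: (free_not0 freeX (mem_tnth _ _)).
have a1 : augm A (gone A) = 1.
  rewrite /augm daddv_pi_id ?memv_line ?augideal_disjoint //.
  have := @coord_free _ _ 1 [tuple gone A] ord0 ord0.
  by rewrite eqxx /= => -> //; rewrite seq1_free.
have aJ u : u \in augideal G -> augm A u = 0.
  move=> uJ; rewrite /augm; set p := daddv_pi _ _.
  suff -> : p u = 0 by rewrite linear0.
  have uS : u \in (<[gone A]> + augideal G)%VS.
    by rewrite (subvP (addvSr _ _)).
  have := daddv_pi_add augideal_disjoint uS.
  rewrite -/p (@daddv_pi_id _ _ (augideal G)) // 1?capvC ?augideal_disjoint //.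
  by move/(canRL (addrK _)); rewrite subrr.
rewrite [v]coord_adapted -(linfun_linearE augm_linear) linear_sum big_ord_recl /=.
rewrite linearZ /= (linfun_linearE augm_linear) (adb_one adX) a1 coord_adapted_sum.
rewrite big1 ?addr0 ?[_ *: _]mulr1 // => b _.
rewrite linearZ /= (linfun_linearE augm_linear) aJ ?scaler0 //.
by apply: augideal_sup (adb_homog adX _); apply: (adb_pos adX).
Qed.

Lemma augm1 : augm A (gone A) = 1.
Proof. by rewrite augmE -(adb_one adX) coord_adapted_elt eqxx. Qed.

Lemma augm_homog i a : a \in G i -> i != 0 -> augm A a = 0.
Proof. by move=> ai i0; rewrite augmE (coord_homog ai) // adb_deg0. Qed.

(** This is where connectedness matters: a product involving a basis element of
    positive degree has positive degree. *)
Lemma augmM a b : augm A (gmul A a b) = augm A a * augm A b.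
Proof.
have xe e : augm A (gmul A (x_ e) b) = augm A (x_ e) * augm A b.
  have [-> | e0] := eqVneq e ord0.
    by rewrite (adb_one adX) gmul1x augm1 mul1r.
  have ne0 n : 0 < n -> n != 0 :> int by move=> h; apply: contraTneq h => ->.
  have e_gt0 : 0 < dg e by apply: lt_le_trans (adb_deg_gt0 e0).
  rewrite (augm_homog (adb_homog adX e)) ?ne0 // mul0r [b]coord_adapted.
  rewrite linear_sum -(linfun_linearE augm_linear) linear_sum big1 //= => c _.
  rewrite !linearZ /= (linfun_linearE augm_linear).
  rewrite (augm_homog (gmul_homog A (adb_homog adX e) (adb_homog adX c))).
    by rewrite scaler0.
  rewrite ne0 // ltr_pwDl //.
  by have [->|/adb_deg_gt0] := eqVneq c ord0; rewrite ?adb_deg0 //; apply: le_trans.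
rewrite {1}[a]coord_adapted linear_sum sum_lfunE -(linfun_linearE augm_linear) linear_sum /=.
rewrite [X in _ = X * _]augmE [a in RHS]coord_adapted linear_sum mulr_suml /=.
apply: eq_bigr => e _; rewrite !linearZ /= scale_lfunE linearZ /=.
by rewrite (linfun_linearE augm_linear) xe -augmE -mulrA.
Qed.

End Adapted.

(** * Graded modules and free modules *)

Lemma bilinfunP (k : fieldType) (U W T : vectType k) (g : U -> W -> T) :
  (forall a, linear (g a)) -> (forall w, linear (g^~ w)) ->
  forall a w, linfun (fun a => linfun (g a)) a w = g a w.
Proof.
move=> lr ll a w; rewrite linfun_linearE ?linfun_linearE // => c u v.
by apply/lfunP => x; rewrite add_lfunE scale_lfunE !linfun_linearE ?ll.
Qed.

Section Homs.
Variables (k : fieldType) (V : vectType k).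
Implicit Types M N P : grmod V.

Lemma grhom_comp M N P (f : 'Hom(N, P)) (g : 'Hom(M, N)) :
  is_grhom f -> is_grhom g -> is_grhom (f \o g)%VF.
Proof.
case=> fa /graded_mapP fg [ga /graded_mapP gg]; split=> [a x|].
  by rewrite !comp_lfunE ga fa.
by apply/graded_mapP => i x xi; rewrite comp_lfunE fg ?gg.
Qed.

Lemma grhom_id M : is_grhom (\1%VF : 'Hom(M, M)).
Proof.
split=> [a x|]; first by rewrite !id_lfunE.
by apply/graded_mapP => i x xi; rewrite id_lfunE.
Qed.

Lemma grhom_lin M N c (f g : 'Hom(M, N)) :
  is_grhom f -> is_grhom g -> is_grhom (f + c *: g).
Proof.
case=> fa /graded_mapP fg [ga /graded_mapP gg]; split=> [a x|].
  by rewrite !add_lfunE !scale_lfunE fa ga linearD linearZ.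
apply/graded_mapP => i x xi.
by rewrite add_lfunE scale_lfunE memvD ?memvZ ?fg ?gg.
Qed.

End Homs.

Section Free.
Variables (k : fieldType) (V : vectType k) (G : grading V) (A : gralg G).
Variables (d : nat) (X : d.+1.-tuple V) (dg : 'I_d.+1 -> int).
Hypothesis adX : adapted_basis A X dg.
Local Notation x_ b := (tnth X b).

Section FreeModule.
Variables (W : vectType k) (H : grading W).
Local Notation F := {ffun 'I_d.+1 -> W}.

(** The function [f] stands for the sum of the [x_b (x) f b], and [A] acts by
    left multiplication on the first factor. *)
Definition free_act (a : V) (f : F) : F :=
  [ffun c => \sum_b coord X c (gmul A a (x_ b)) *: f b].

Definition freemod : grmod V :=
  GrMod (ffun_grading H dg) (linfun (fun a => linfun (free_act a))).

Lemma free_actE a (f : freemod) : mact freemod a f = free_act a f.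
Proof.
apply: bilinfunP => [{}a|{}f] c u v; apply/ffunP => e; rewrite !ffunE.
  rewrite scaler_sumr -big_split; apply: eq_bigr => b _ /=.
  by rewrite !ffunE scalerDr !scalerA mulrC.
rewrite scaler_sumr -big_split; apply: eq_bigr => b _ /=.
by rewrite !linearP /= add_lfunE scale_lfunE linearP scalerDl scalerA.
Qed.

Lemma free_is_grmod : is_grmod A freemod.
Proof.
split=> [f|a b f|i j a f ai /ffun_compP fj].
- rewrite free_actE; apply/ffunP => c; rewrite ffunE (bigD1 c) //=.
  rewrite gmul1x (coord_adapted_elt adX) eqxx scale1r big1 ?addr0 // => e ec.
  by rewrite gmul1x (coord_adapted_elt adX) (negPf ec) scale0r.
- rewrite !free_actE; apply/ffunP => c; rewrite !ffunE.
  under [RHS]eq_bigr => e _ do rewrite ffunE scaler_sumr.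
  rewrite exchange_big /=; apply: eq_bigr => e _.
  rewrite gmulA {1}[gmul A b _](coord_adapted adX) linear_sum linear_sum scaler_suml.
  by apply: eq_bigr => h _; rewrite !linearZ /= scalerA mulrC.
- rewrite free_actE; apply/ffun_compP => c; rewrite ffunE memv_suml // => b _.
  have [e|ne] := eqVneq (i + dg b) (dg c); last first.
    rewrite (coord_homog adX (gmul_homog A ai (adb_homog adX b))) //.
    by rewrite scale0r mem0v.
  rewrite memvZ //; have := fj b.
  by rewrite -e opprD addrACA subrr add0r.
Qed.

Definition one_tens : 'Hom(W, freemod) := linfun (delta_ffun ord0).

Lemma one_tensE w : one_tens w = delta_ffun ord0 w.
Proof. exact/linfun_linearE/delta_ffun_linear. Qed.

Lemma one_tens_graded : graded_map H (mgr freemod) one_tens.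
Proof.
apply/graded_mapP => i w wi; rewrite one_tensE; apply/ffun_compP => b.
rewrite ffunE; case: eqP => [->|_]; last exact: mem0v.
by rewrite (adb_deg0 adX) subr0.
Qed.

Lemma free_act_one b w : mact freemod (x_ b) (one_tens w) = delta_ffun b w.
Proof.
rewrite free_actE one_tensE; apply/ffunP => c; rewrite !ffunE.
rewrite (bigD1 ord0) //= ffunE eqxx (adb_one adX) gmulx1.
rewrite (coord_adapted_elt adX) big1 ?addr0 => [|e /negPf e0].
  by rewrite eq_sym; case: eqP; rewrite ?scale1r ?scale0r.
by rewrite ffunE e0 scaler0.
Qed.

Lemma free_decomp (f : freemod) :
  f = \sum_b mact freemod (x_ b) (one_tens ((f : F) b)).
Proof.
by rewrite {1}[f]ffun_delta_sum; apply: eq_bigr => b _; rewrite free_act_one.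
Qed.

Lemma free_hom_ext (M : grmod V) (h1 h2 : 'Hom(freemod, M)) :
  (forall a x, h1 (mact freemod a x) = mact M a (h1 x)) ->
  (forall a x, h2 (mact freemod a x) = mact M a (h2 x)) ->
  (forall w, h1 (one_tens w) = h2 (one_tens w)) -> h1 = h2.
Proof.
move=> a1 a2 h12; apply/lfunP => f; rewrite [f]free_decomp !linear_sum /=.
by apply: eq_bigr => b _; rewrite a1 a2 h12.
Qed.

Section Ext.
Variables (M : grmod V) (phi : 'Hom(W, M)).
Hypotheses (grM : is_grmod A M).

Definition free_ext : 'Hom(freemod, M) :=
  linfun (fun f : F => \sum_b mact M (x_ b) (phi (f b))).

Lemma free_extE (f : freemod) :
  free_ext f = \sum_b mact M (x_ b) (phi ((f : F) b)).
Proof.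
apply: linfun_linearE => c u v; rewrite scaler_sumr -big_split; apply: eq_bigr => b _.
by rewrite !ffunE !linearP.
Qed.

Lemma free_ext_one w : free_ext (one_tens w) = phi w.
Proof.
rewrite free_extE one_tensE (bigD1 ord0) //= big1 => [|b /negPf b0].
  by rewrite ffunE eqxx (adb_one adX) addr0; case: grM => ->.
by rewrite ffunE b0 !linear0.
Qed.

Lemma free_ext_elt b w :
  free_ext (mact freemod (x_ b) (one_tens w)) = mact M (x_ b) (phi w).
Proof.
rewrite free_act_one free_extE (bigD1 b) //= big1 ?addr0 => [|c /negPf cb].
  by rewrite ffunE eqxx.
by rewrite ffunE cb !linear0.
Qed.

Lemma free_ext_hom : graded_map H (mgr M) phi -> is_grhom free_ext.
Proof.
move/graded_mapP => phig; case: grM => _ MA Mg; split=> [a f|].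
  rewrite [in LHS]free_extE [f in RHS]free_decomp !linear_sum /=.
  rewrite free_actE.
  under eq_bigr => c _ do rewrite ffunE !linear_sum.
  rewrite exchange_big; apply: eq_bigr => b _ /=.
  rewrite free_ext_elt -MA {2}[gmul A a _](coord_adapted adX).
  rewrite linear_sum sum_lfunE; apply: eq_bigr => c _.
  by rewrite !linearZ /= scale_lfunE.
apply/graded_mapP => i f /ffun_compP fi; rewrite free_extE memv_suml // => b _.
by rewrite -[i](subrKC (dg b)) Mg ?phig ?(adb_homog adX).
Qed.

End Ext.

(** Freeness: a map is determined by its values on [1 (x) w], which can be
    chosen freely, and a graded section of [g] on its image provides them. Asking
    for an inclusion of images instead of surjectivity of [g] makes the lemma
    usable along an exact complex without forming the image as a module. *)
Lemma free_lift (M N : grmod V) (g : 'Hom(M, N)) (f : 'Hom(freemod, N)) :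
  is_grmod A M -> is_grmod A N -> is_grhom g -> is_grhom f ->
  (limg f <= limg g)%VS -> exists2 h : 'Hom(freemod, M), is_grhom h & (g \o h)%VF = f.
Proof.
move=> grM grN [ga gg] [fa /graded_mapP fg] /subvP fsub.
pose s := graded_section (mgr M) (mgr N) g.
have phig : graded_map H (mgr M) (s \o f \o one_tens)%VF.
  apply/graded_mapP => i w wi; rewrite !comp_lfunE.
  apply: graded_section_mem; apply: fg.
  by move/graded_mapP: one_tens_graded; apply.
have [ha hg] := free_ext_hom grM phig.
exists (free_ext (s \o f \o one_tens)%VF) => //.
apply: (free_hom_ext (M := N)) => // [a x|w]; first by rewrite !comp_lfunE ha ga.
rewrite comp_lfunE free_ext_one // !comp_lfunE.
by apply: graded_sectionK gg _ _; rewrite fsub ?memv_img ?memvf.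
Qed.

Lemma free_grproj : is_grproj A freemod.
Proof.
split=> [|M N g f grM grN gh fh gs]; first exact: free_is_grmod.
by apply: free_lift => //; rewrite gs subvf.
Qed.

End FreeModule.

Definition free_cover (M : grmod V) : 'Hom(freemod (mgr M), M) :=
  free_ext (mgr M) \1%VF.

Lemma free_cover_hom (M : grmod V) : is_grmod A M -> is_grhom (free_cover M).
Proof.
move=> grM; apply: free_ext_hom => //; apply/graded_mapP => i x.
by rewrite id_lfunE.
Qed.

Lemma free_cover_one (M : grmod V) x :
  is_grmod A M -> free_cover M (one_tens _ x) = x.
Proof. by move=> grM; rewrite free_ext_one // id_lfunE. Qed.

Lemma free_cover_surj (M : grmod V) : is_grmod A M -> limg (free_cover M) = fullv.
Proof.
move=> grM; apply/eqP; rewrite eqEsubv subvf; apply/subvP => x _.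
by rewrite -(free_cover_one x grM) memv_img ?memvf.
Qed.

(** The definition of projectivity lifts only along surjections. It makes [P] a
    direct summand of the free module on its underlying graded space, and the
    stronger lifting property of [free_lift] passes to direct summands. *)
Lemma proj_lift (P M N : grmod V) (g : 'Hom(M, N)) (f : 'Hom(P, N)) :
  is_grproj A P -> is_grmod A M -> is_grmod A N -> is_grhom g -> is_grhom f ->
  (limg f <= limg g)%VS -> exists2 h : 'Hom(P, M), is_grhom h & (g \o h)%VF = f.
Proof.
case=> grP projP grM grN gh fh fg.
have [s sh sK] := projP _ _ _ _ (free_is_grmod (mgr P)) grP (free_cover_hom grP)
  (grhom_id P) (free_cover_surj grP).
(* [free_cover P] followed by [f] lifts by freeness; compose the lift with
   the section [s]. *)
have [|h hh hE] := free_lift grM grN gh (grhom_comp fh (free_cover_hom grP)).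
  by apply: subv_trans fg; rewrite limg_comp limgS ?subvf.
exists (h \o s)%VF; first exact: grhom_comp.
by rewrite comp_lfunA hE -comp_lfunA sK comp_lfun1r.
Qed.

End Free.

(** * Independence of the projective resolution *)

Section Comparison.
Variables (k : fieldType) (V : vectType k) (G : grading V) (A : gralg G).
Variables (d : nat) (X : d.+1.-tuple V) (dg : 'I_d.+1 -> int).
Hypothesis adX : adapted_basis A X dg.

Lemma mem_tens_rel (M : grmod V) a (x : M) :
  augm A a *: x - mact M a x \in tens_rel A M.
Proof.
rewrite [a](coord_vbasis (memvf a)) -(linfun_linearE (augm_linear A)) !linear_sum /=.
rewrite scaler_suml sum_lfunE -sumrB memv_suml // => i _.
rewrite !linearZ /= scale_lfunE -scalerA -scalerBr memvZ //.
have vi : (vbasis {:V})`_i \in vbasis {:V} by rewrite mem_nth ?size_tuple.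
rewrite /tens_rel (big_rem _ vi) /=; apply: (subvP (addvSl _ _)).
rewrite (_ : _ - _ = (augm A (vbasis {:V})`_i *: \1%VF
  - mact M (vbasis {:V})`_i) x) ?memv_img ?memvf //.
by rewrite add_lfunE opp_lfunE scale_lfunE id_lfunE (linfun_linearE (augm_linear A)).
Qed.

Lemma tens_rel_sub (M : grmod V) (U : {vspace M}) :
  (forall a x, augm A a *: x - mact M a x \in U) -> (tens_rel A M <= U)%VS.
Proof.
move=> aU; rewrite /tens_rel; elim/big_ind: _ => [|U1 U2 h1 h2|a _].
- exact: sub0v.
- by rewrite subv_add h1 h2.
apply/subvP => _ /memv_imgP[x _ ->].
by rewrite add_lfunE opp_lfunE scale_lfunE id_lfunE.
Qed.

(** A module map induces a map after tensoring with k over A. *)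
Lemma grhom_tens_rel (M N : grmod V) (f : 'Hom(M, N)) x :
  is_grhom f -> x \in tens_rel A M -> f x \in tens_rel A N.
Proof.
case=> fa _; rewrite [f x \in _]memv_preim; apply/subvP/tens_rel_sub => a {}x.
by rewrite -memv_preim linearB linearZ /= fa mem_tens_rel.
Qed.

Lemma triv_actE a (x : trivmod A) : mact (trivmod A) a x = augm A a *: x.
Proof.
rewrite linfun_linearE; first by rewrite scale_lfunE id_lfunE.
by move=> c u v; rewrite augm_linear scalerDl scalerA.
Qed.

Lemma deg0_gradingP i (x : k^o) :
  (x \in deg0_grading k i) = (i == 0) || (x == 0).
Proof. by rewrite /= /deg0_comp; case: ifP => _; rewrite ?memvf ?memv0. Qed.

Lemma triv_is_grmod : is_grmod A (trivmod A).
Proof.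
split=> [x|a b x|i j a x ai]; rewrite !triv_actE.
- by rewrite (augm1 adX) scale1r.
- by rewrite (augmM adX) scalerA.
rewrite !deg0_gradingP => /orP[/eqP->|/eqP->]; last by rewrite scaler0 eqxx orbT.
rewrite addr0; have [//|i0] := eqVneq i 0.
by rewrite (augm_homog adX ai i0) scale0r eqxx.
Qed.

(** The augmentation plays the role of the differential in degree 0, so that
    exactness takes the same form in all degrees. *)
Definition res_ker (P : grres V) n : {vspace rmod P n} :=
  if n is n'.+1 then lker (rdiff P n') else lker (raug P).

Lemma res_exact P n : is_projres A P -> limg (rdiff P n) = res_ker P n.
Proof. by case=> _ [_ e0 e]; case: n. Qed.

(** Chain maps [f], [g] between the resolutions and a homotopy [h] from the
    identity to [f \o g] are built together, one degree at a time. The map [e]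
    is the part [h \o rdiff] of the homotopy formula that comes from the degree
    below; recording only that it kills [res_ker Q n] and sends cycles into
    [tens_rel] keeps the induction hypothesis inside a single degree. The maps
    [f] and [g] send [res_ker] to [res_ker], which is what allows the next
    lifting step. *)
Lemma projres_compare P Q : is_projres A P -> is_projres A Q -> forall n,
  exists (f : 'Hom(rmod P n, rmod Q n)) (g : 'Hom(rmod Q n, rmod P n))
         (h : 'Hom(rmod Q n, rmod Q n.+1)) (e : 'End(rmod Q n)),
  [/\ is_grhom f, is_grhom g, is_grhom h &
      (g @: tor_cycles A Q n <= tor_cycles A P n)%VS] /\
  [/\ (f @: res_ker P n <= res_ker Q n)%VS, (g @: res_ker Q n <= res_ker P n)%VS,
      (f \o g = \1 + e + (rdiff Q n \o h))%VF, (res_ker Q n <= lker e)%VS &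
      (e @: tor_cycles A Q n <= tens_rel A (rmod Q n))%VS].
Proof.
move=> rP rQ.
have [[pP dP aP] [aPs _ _]] := rP; have [[pQ dQ aQ] [aQs _ _]] := rQ.
have grP n : is_grmod A (rmod P n) by case: (pP n).
have grQ n : is_grmod A (rmod Q n) by case: (pQ n).
have homotopy n (u : 'End(rmod Q n)) : is_grhom u -> (limg u <= res_ker Q n)%VS ->
    exists2 h : 'Hom(rmod Q n, rmod Q n.+1), is_grhom h & (rdiff Q n \o h)%VF = u.
  by move=> uh uk; apply: (proj_lift adX) => //; rewrite res_exact.
elim=> [|n [f [g [h [e [[fh gh hh gc] [fk gk fgE ek ec]]]]]]].
  have trG := triv_is_grmod.
  have [|f fh fE] := @proj_lift _ _ _ _ _ _ _ adX _ _ (trivmod A) (raug Q) (raug P)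
    (pP 0%N) (grQ 0%N) trG aQ aP; first by rewrite aQs subvf.
  have [|g gh gE] := @proj_lift _ _ _ _ _ _ _ adX _ _ (trivmod A) (raug P) (raug Q)
    (pQ 0%N) (grP 0%N) trG aP aQ; first by rewrite aPs subvf.
  have fE' x : raug Q (f x) = raug P x by rewrite -fE comp_lfunE.
  have gE' x : raug P (g x) = raug Q x by rewrite -gE comp_lfunE.
  have [||h hh hE] := @homotopy 0%N (f \o g - \1)%VF.
  - rewrite -scaleN1r; apply: grhom_lin; last exact: grhom_id.
    exact: grhom_comp.
  - apply/subvP => _ /memv_imgP[x _ ->]; rewrite memv_ker.
    by rewrite add_lfunE opp_lfunE comp_lfunE id_lfunE linearB /= fE' gE' subrr.
  exists f, g, h, 0; split; first by split=> //; apply: subvf.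
split.
  - apply/subvP => _ /memv_imgP[x xk ->]; rewrite memv_ker fE' -memv_ker.
    exact: xk.
  - apply/subvP => _ /memv_imgP[x xk ->]; rewrite memv_ker gE' -memv_ker.
    exact: xk.
  - by rewrite hE addr0 addrC subrK.
  - by apply/subvP => x _; rewrite memv_ker lfunE.
  - by rewrite lim0g sub0v.
have [f' fh' fE'] : exists2 f' : 'Hom(rmod P n.+1, rmod Q n.+1), is_grhom f' &
    (rdiff Q n \o f' = f \o rdiff P n)%VF.
  apply: (proj_lift adX) => //; first exact: grhom_comp.
  by rewrite limg_comp !res_exact.
have [g' gh' gE'] : exists2 g' : 'Hom(rmod Q n.+1, rmod P n.+1), is_grhom g' &
    (rdiff P n \o g' = g \o rdiff Q n)%VF.
  apply: (proj_lift adX) => //; first exact: grhom_comp.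
  by rewrite limg_comp !res_exact.
have fE x : rdiff Q n (f' x) = f (rdiff P n x) by rewrite -!comp_lfunE fE'.
have gE x : rdiff P n (g' x) = g (rdiff Q n x) by rewrite -!comp_lfunE gE'.
pose e' := (h \o rdiff Q n)%VF.
have [||h' hh' hE'] := @homotopy n.+1 (f' \o g' - \1 - e')%VF.
- rewrite -!scaleN1r; apply: grhom_lin; last exact: grhom_comp.
  by apply: grhom_lin; [apply: grhom_comp | apply: grhom_id].
- apply/subvP => _ /memv_imgP[x _ ->]; rewrite memv_ker !add_lfunE !opp_lfunE.
  rewrite !comp_lfunE id_lfunE !linearB /= fE gE.
  have := congr1 (fun u : 'End(_) => u (rdiff Q n x)) fgE.
  rewrite !add_lfunE !comp_lfunE id_lfunE => ->.
  have /subvP/(_ (rdiff Q n x)) := ek; rewrite memv_ker => /(_ _)/eqP->.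
    by rewrite addr0 -addrA -opprD subrr.
  by rewrite -res_exact // memv_img ?memvf.
exists f', g', h', e'; split.
  split=> //; apply/subvP => _ /memv_imgP[x xc ->].
  by rewrite -memv_preim gE (grhom_tens_rel gh) // memv_preim.
split.
- apply/subvP => _ /memv_imgP[x xk ->]; rewrite memv_ker fE.
  by move: xk; rewrite memv_ker => /eqP->; rewrite linear0.
- apply/subvP => _ /memv_imgP[x xk ->]; rewrite memv_ker gE.
  by move: xk; rewrite memv_ker => /eqP->; rewrite linear0.
- by rewrite hE' [RHS]addrC -[X in X + _]addrA -opprD subrK.
- apply/subvP => x; rewrite !memv_ker comp_lfunE => /eqP->.
  by rewrite linear0.
- apply/subvP => _ /memv_imgP[x xc ->]; rewrite comp_lfunE.
  by apply: grhom_tens_rel => //; rewrite memv_preim.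
Qed.

(** A cycle [z] is compared with [f (g z)]: by assumption [g z] is a boundary,
    and the homotopy shows that the difference is one, too. *)
Lemma tor_independent P Q n j : is_projres A P -> is_projres A Q ->
  (tor_cycles A P n :&: mgr (rmod P n) j <= tor_bounds A P n)%VS ->
  (tor_cycles A Q n :&: mgr (rmod Q n) j <= tor_bounds A Q n)%VS.
Proof.
move=> rP rQ /subvP vP.
have [f [g [h [e [[fh gh hh gc] [fk gk fgE ek ec]]]]]] := projres_compare rP rQ n.
apply/subvP => z /memv_capP[zc zj].
have gz : g z \in tor_bounds A P n.
  apply: vP; apply/memv_capP; split; first exact/(subvP gc)/memv_img.
  by case: gh => _ /graded_mapP; apply.
have fgz : f (g z) \in tor_bounds A Q n.
  case/memv_addP: gz => _ /memv_imgP[p _ ->] [t tt ->]; rewrite linearD memv_add //.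
    rewrite (res_exact n rQ); apply/(subvP fk)/memv_img.
    by rewrite -(res_exact n rP) memv_img ?memvf.
  exact: grhom_tens_rel tt.
have := congr1 (fun u : 'End(_) => u z) fgE.
rewrite !add_lfunE !comp_lfunE id_lfunE -addrA => /esym/(canRL (addrK _)) ->.
rewrite memvB // addrC memv_add ?memv_img ?memvf //.
exact/(subvP ec)/memv_img.
Qed.

End Comparison.

(** * The bar resolution *)

Section Syzygy.
Variables (k : fieldType) (V : vectType k) (G : grading V) (A : gralg G).
Variables (d : nat) (X : d.+1.-tuple V) (dg : 'I_d.+1 -> int).
Hypothesis adX : adapted_basis A X dg.
Local Notation x_ b := (tnth X b).
Local Notation x1_ b := (tnth X (lift ord0 b)).
Local Notation freem H := (freemod A X dg H).

Section OneModule.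
Variable M : grmod V.
Local Notation J := {ffun 'I_d -> M}.
Local Notation F := (freem (mgr M)).

(** The multiplication map J (x) M -> M. *)
Definition syz_mul (g : J) : M := \sum_b mact M (x1_ b) (g b).

Lemma syz_mul_linear : linear syz_mul.
Proof.
move=> c u v; rewrite scaler_sumr -big_split; apply: eq_bigr => b _.
by rewrite !ffunE linearP.
Qed.

(** The map sending x (x) m to x (x) m - 1 (x) x m, which identifies J (x) M
    with the kernel of A (x) M -> M; the coordinates other than the 0-th recover
    the argument. *)
Definition syz_in : 'Hom(J, F) :=
  linfun (fun g : J => [ffun i => if unlift ord0 i is Some b then g b
                                  else - syz_mul g]).

Lemma syz_inE g : syz_in g =
  [ffun i => if unlift ord0 i is Some b then g b else - syz_mul g].
Proof.
apply: linfun_linearE => c u v; apply/ffunP => i; rewrite !ffunE.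
case: unlift => [b|]; first by rewrite !ffunE.
by rewrite syz_mul_linear opprD scalerN.
Qed.

Definition syz_out : 'Hom(F, J) :=
  linfun (fun f : {ffun 'I_d.+1 -> M} => [ffun b => f (lift ord0 b)]).

Lemma syz_outE f : syz_out f = [ffun b => (f : {ffun _}) (lift ord0 b)].
Proof. by apply: linfun_linearE => c u v; apply/ffunP => i; rewrite !ffunE. Qed.

Lemma syz_inK g : syz_out (syz_in g) = g.
Proof.
by apply/ffunP => b; rewrite syz_outE ffunE syz_inE ffunE liftK.
Qed.

(** The action on the kernel of A (x) M -> M, transported to J (x) M. *)
Definition syz_act : 'Hom(V, 'End(J)) :=
  linfun (fun a => (syz_out \o mact F a \o syz_in)%VF).

Lemma syz_actE a g : syz_act a g = syz_out (mact F a (syz_in g)).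
Proof.
rewrite linfun_linearE ?comp_lfunE // => c u v; apply/lfunP => {}g.
rewrite add_lfunE scale_lfunE !comp_lfunE -linearP; congr (syz_out _).
by rewrite linearP add_lfunE scale_lfunE.
Qed.

Definition syz : grmod V :=
  GrMod (ffun_grading (mgr M) (fun b => dg (lift ord0 b))) syz_act.

Hypothesis grM : is_grmod A M.

Lemma free_coverE (f : F) : free_cover A X dg M f =
  (f : {ffun _}) ord0 + syz_mul (syz_out f).
Proof.
rewrite free_extE big_ord_recl !id_lfunE (adb_one adX).
case: grM => -> _ _; congr (_ + _); apply: eq_bigr => b _.
by rewrite id_lfunE syz_outE ffunE.
Qed.

Lemma syz_in_ker g : free_cover A X dg M (syz_in g) = 0.
Proof. by rewrite free_coverE syz_inK syz_inE ffunE unlift_none addNr. Qed.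

(** An element of the kernel is determined by its coordinates of index other
    than 0, as 1 (x) m is sent to m. *)
Lemma syz_outK f : free_cover A X dg M f = 0 -> syz_in (syz_out f) = f.
Proof.
rewrite free_coverE addrC => /(canRL (addKr _)); rewrite addr0 => f0.
rewrite syz_inE; apply/ffunP => i; rewrite ffunE.
case: (unliftP ord0 i) => [b ->|->]; last by rewrite f0.
by rewrite syz_outE ffunE.
Qed.

Lemma limg_syz_in : limg syz_in = lker (free_cover A X dg M).
Proof.
apply/eqP; rewrite eqEsubv; apply/andP; split; apply/subvP => f.
  by case/memv_imgP => g _ ->; rewrite memv_ker syz_in_ker.
by rewrite memv_ker => /eqP/syz_outK <-; rewrite memv_img ?memvf.
Qed.

Lemma syz_in_act a g : syz_in (syz_act a g) = mact F a (syz_in g).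
Proof.
rewrite syz_actE syz_outK //.
by case: (free_cover_hom adX grM) => -> _; rewrite syz_in_ker linear0.
Qed.

Lemma syz_out_graded i (f : F) : f \in mgr F i -> syz_out f \in mgr syz i.
Proof.
move=> /ffun_compP fi; apply/ffun_compP => b.
by rewrite syz_outE ffunE; apply: fi.
Qed.

Lemma syz_mul_graded i (g : J) : g \in mgr syz i -> syz_mul g \in mgr M i.
Proof.
move=> /ffun_compP gi; rewrite memv_suml // => b _.
case: grM => _ _ Mg; rewrite -[i](subrKC (dg (lift ord0 b))).
by rewrite Mg ?(adb_homog adX).
Qed.

Lemma syz_in_hom : is_grhom (syz_in : 'Hom(syz, F)).
Proof.
split=> [a g|]; first exact: syz_in_act.
apply/graded_mapP => i g gi; apply/ffun_compP => c; rewrite syz_inE ffunE.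
case: (unliftP ord0 c) => [b ->|->]; last first.
  by rewrite (adb_deg0 adX) subr0 memvN syz_mul_graded.
by move/ffun_compP: gi; apply.
Qed.

Lemma syz_is_grmod : is_grmod A syz.
Proof.
have [F1 FA Fg] := free_is_grmod adX (mgr M).
split=> [g|a b g|i j a g ai gj] /=.
- by rewrite syz_actE F1 syz_inK.
- by rewrite syz_actE FA -syz_in_act -syz_actE.
rewrite syz_actE; apply: syz_out_graded; apply: Fg => //.
by case: syz_in_hom => _ /graded_mapP; apply.
Qed.

(** a.(x (x) m) = ax (x) m - a (x) xm, in coordinates. Apart from the action on
    M, only the structure constants of J occur. *)
Lemma syz_act_elt a g : syz_act (x1_ a) g =
  [ffun c => \sum_b coord X (lift ord0 c) (gmul A (x1_ a) (x1_ b)) *: g b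
             - (if c == a then syz_mul g else 0)].
Proof.
rewrite syz_actE syz_outE free_actE; apply/ffunP => c; rewrite !ffunE.
rewrite big_ord_recl addrC (adb_one adX) gmulx1 (coord_adapted_elt adX).
rewrite syz_inE ffunE unlift_none (inj_eq lift_inj) [c == a]eq_sym; congr (_ + _).
  by apply: eq_bigr => b _; rewrite ffunE liftK.
by case: eqP; rewrite ?scale1r ?scale0r ?oppr0.
Qed.

End OneModule.

Section Bar.

(** The carrier of the n-th syzygy of k, defined apart from the action so that
    it is the same space for all algebras with the same dimension. *)
Fixpoint barW (n : nat) : vectType k :=
  if n is n'.+1 then Vector.clone k {ffun 'I_d -> barW n'} _ else k^o.

Fixpoint bar_gr (del : 'I_d -> int) (n : nat) : grading (barW n) :=
  if n is n'.+1 then ffun_grading (bar_gr del n') del else deg0_grading k.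

End Bar.
Local Notation del := (fun b : 'I_d => dg (lift ord0 b)).

Fixpoint bar_act (n : nat) : 'Hom(V, 'End(barW n)) :=
  if n is n'.+1 then syz_act (GrMod (bar_gr del n') (bar_act n'))
  else mact (trivmod A).

Definition barmod (n : nat) : grmod V := GrMod (bar_gr del n) (bar_act n).

Lemma bar_is_grmod n : is_grmod A (barmod n).
Proof.
elim: n => [|n IHn]; first exact: triv_is_grmod adX.
exact: (syz_is_grmod IHn).
Qed.

Definition bar_free n : grmod V := freem (bar_gr del n).

Definition bar_syz_in n : 'Hom(barmod n.+1, bar_free n) := syz_in (barmod n).

Definition bar_cover n : 'Hom(bar_free n, barmod n) :=
  free_cover A X dg (barmod n).

Definition bar_res : grres V :=
  @GrRes _ _ bar_free (fun n => bar_syz_in n \o bar_cover n.+1)%VF (bar_cover 0).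

Lemma bar_projres : is_projres A bar_res.
Proof.
have img n : limg (bar_syz_in n \o bar_cover n.+1)%VF = lker (bar_cover n).
  have cs : limg (bar_cover n.+1) = fullv.
    exact (free_cover_surj adX (bar_is_grmod n.+1)).
  rewrite limg_comp cs.
  exact: (limg_syz_in (bar_is_grmod n)).
split; split.
- by move=> n; exact (free_grproj adX (bar_gr del n)).
- move=> n; apply: grhom_comp; first exact (syz_in_hom (bar_is_grmod n)).
  exact (free_cover_hom adX (bar_is_grmod n.+1)).
- exact (free_cover_hom adX (bar_is_grmod 0)).
- exact (free_cover_surj adX (bar_is_grmod 0)).
- exact: img.
move=> n; rewrite [LHS]img; apply/vspaceP => x; rewrite !memv_ker comp_lfunE.
have in0 : lker (bar_syz_in n) == 0%VS.
  by apply/lker0P; apply: can_inj (@syz_inK (barmod n)).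
by rewrite -(inj_eq (lker0P in0)) linear0.
Qed.

End Syzygy.

(** * Tor in terms of structure constants *)

Section BarComplex.
Variables (k : fieldType) (d : nat) (T : 'I_d -> 'I_d -> 'I_d -> k).

(** The action of the basis elements of J on the iterated syzygies of k, as in
    [syz_act_elt], with arbitrary scalars in place of the structure constants of
    an algebra. In this form it can be viewed as a function of those scalars. *)
Fixpoint bar_op (n : nat) (a : 'I_d) : barW k d n -> barW k d n :=
  match n return barW k d n -> barW k d n with
  | 0%N => fun _ => 0
  | n'.+1 => fun g : {ffun 'I_d -> barW k d n'} =>
      [ffun c => \sum_b T a b c *: g b
                 - (if c == a then \sum_b @bar_op n' b (g b) else 0)]
  end.

Definition bar_diff n (g : barW k d n.+1) : barW k d n :=
  \sum_b @bar_op n b ((g : {ffun 'I_d -> barW k d n}) b).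

Lemma bar_diff_linear_of n :
  (forall a, linear (@bar_op n a)) -> linear (@bar_diff n).
Proof.
move=> lin c u v; rewrite scaler_sumr -big_split; apply: eq_bigr => b _.
by rewrite !ffunE lin.
Qed.

Lemma bar_op_linear n a : linear (@bar_op n a).
Proof.
elim: n a => [|n IHn] a c u v /=; first by rewrite scaler0 addr0.
have lin := bar_diff_linear_of IHn; apply/ffunP => e; rewrite !ffunE.
have -> : \sum_b T a b e *: (c *: u + v : {ffun 'I_d -> barW k d n}) b =
    c *: (\sum_b T a b e *: (u : {ffun 'I_d -> barW k d n}) b)
    + \sum_b T a b e *: (v : {ffun 'I_d -> barW k d n}) b.
  rewrite scaler_sumr -big_split; apply: eq_bigr => b _.
  by rewrite !ffunE scalerDr !scalerA mulrC.
have := lin c u v; rewrite /bar_diff => ->.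
case: ifP => _; last by rewrite !subr0.
by rewrite scalerBr opprD addrACA.
Qed.

Lemma bar_diff_linear n : linear (@bar_diff n).
Proof. exact/bar_diff_linear_of/bar_op_linear. Qed.

Definition bar_map n : 'Hom(barW k d n.+1, barW k d n) := linfun (@bar_diff n).

Lemma bar_mapE n g : bar_map n g = bar_diff g.
Proof. exact/linfun_linearE/bar_diff_linear. Qed.

(** Exactness in degree [j] at the tensor power J^(x)(n+1), where Tor_(n+1) is
    computed. *)
Definition bar_exact (del : 'I_d -> int) n j : bool :=
  (lker (bar_map n) :&: bar_gr k del n.+1 j <= limg (bar_map n.+1))%VS.

End BarComplex.

Section TorBar.
Variables (k : fieldType) (V : vectType k) (G : grading V) (A : gralg G).
Variables (d : nat) (X : d.+1.-tuple V) (dg : 'I_d.+1 -> int).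
Hypothesis adX : adapted_basis A X dg.
Local Notation x_ b := (tnth X b).
Local Notation x1_ b := (tnth X (lift ord0 b)).
Local Notation del := (fun b : 'I_d => dg (lift ord0 b)).
Local Notation barm := (barmod A X dg).
Local Notation Q := (bar_res A X dg).

Definition struct_const (a b c : 'I_d) : k :=
  coord X (lift ord0 c) (gmul A (x1_ a) (x1_ b)).
Local Notation T := struct_const.

Lemma bar_actE n a (w : barm n) : mact (barm n) (x1_ a) w = bar_op T a w.
Proof.
elim: n a w => [|n IHn] a w.
  by rewrite triv_actE (augm_homog adX (adb_homog adX _)) ?scale0r // gt_eqF //
    (lt_le_trans ltr01) ?(adb_pos adX).
rewrite [LHS](syz_act_elt adX (M := barm n) a w); apply/ffunP => c; rewrite !ffunE.
by congr (_ - _); case: ifP => // _; apply: eq_bigr => b _; exact: IHn.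
Qed.

Lemma bar_map_syz n (g : barm n.+1) : bar_map T n g = syz_mul X (M := barm n) g.
Proof. by rewrite bar_mapE; apply: eq_bigr => b _; rewrite -bar_actE. Qed.

Lemma bar_map_graded n : graded_map (bar_gr k del n.+1) (bar_gr k del n) (bar_map T n).
Proof.
apply/graded_mapP => i g gi; rewrite bar_map_syz.
exact (syz_mul_graded adX (bar_is_grmod adX n) gi).
Qed.

Section FreeTens.
Variables (W : vectType k) (H : grading W).
Local Notation F := (freemod A X dg H).

Definition free_red : 'Hom(F, W) := linfun (fun f : {ffun 'I_d.+1 -> W} => f ord0).

Lemma free_redE (f : F) : free_red f = (f : {ffun _}) ord0.
Proof. exact/linfun_linearE/ev_linear. Qed.

Lemma free_red_one w : free_red (one_tens A X dg H w) = w.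
Proof. by rewrite free_redE one_tensE ffunE eqxx. Qed.

Lemma free_red_graded i f : f \in mgr F i -> free_red f \in H i.
Proof.
move/ffun_compP/(_ ord0); rewrite (adb_deg0 adX) subr0 free_redE.
exact.
Qed.

(** k (x)_A (A (x) W) is W: the relations span J (x) W. *)
Lemma free_tens_rel : tens_rel A F = lker free_red.
Proof.
apply/eqP; rewrite eqEsubv; apply/andP; split.
  apply: tens_rel_sub => a f; rewrite memv_ker linearB linearZ /= !free_redE.
  rewrite free_actE ffunE (bigD1 ord0) //= big1 ?addr0 => [|b b0].
    by rewrite -(augmE adX) (augmM adX) (adb_one adX) (augm1 adX) mulr1 subrr.
  rewrite -(augmE adX) (augmM adX) [X in _ * X](augmE adX).
  by rewrite (coord_adapted_elt adX) (negPf b0) mulr0 scale0r.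
apply/subvP => f; rewrite memv_ker free_redE => /eqP f0.
rewrite [f](free_decomp adX) memv_suml // => b _.
case: (unliftP ord0 b) => [c ->|->]; last by rewrite f0 !linear0 mem0v.
have := mem_tens_rel A (x1_ c) (one_tens A X dg H ((f : {ffun _}) (lift ord0 c))).
rewrite (augmE adX) (coord_adapted_elt adX) scale0r sub0r memvN.
exact.
Qed.

End FreeTens.

Local Notation pr n := (free_red (bar_gr k del n)).

(** Modulo the relations, [x] may be replaced by 1 (x) w with [w] its reduction;
    the differential sends it to the image of [w] under [syz_in], whose 0-th
    coordinate is minus the product. *)
Lemma free_red_rdiff n (x : rmod Q n.+1) :
  pr n (rdiff Q n x) = - bar_map T n (pr n.+1 x).
Proof.
have [_ dh _] := (bar_projres adX).1.
pose w := pr n.+1 x; pose o := one_tens A X dg (bar_gr k del n.+1) w.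
(* [x] and [o] have the same image after tensoring, hence so do their
   differentials. *)
have /(grhom_tens_rel (dh n)) : x - o \in tens_rel A (rmod Q n.+1).
  by rewrite free_tens_rel memv_ker linearB /= free_red_one subrr.
rewrite free_tens_rel memv_ker !linearB subr_eq0 /= => /eqP ->.
have coverE : bar_cover A X dg n.+1 o = w.
  exact (free_cover_one adX (M := barm n.+1) w (bar_is_grmod adX n.+1)).
rewrite comp_lfunE coverE free_redE bar_map_syz.
have -> : bar_syz_in A X dg n w = _ := syz_inE A X dg (M := barm n) w.
by rewrite ffunE unlift_none.
Qed.

Lemma bar_map_comp n g : bar_map T n (bar_map T n.+1 g) = 0.
Proof.
pose o := one_tens A X dg (bar_gr k del n.+2) g.
have [_ [_ _ ex]] := bar_projres adX.
have : rdiff Q n.+1 o \in lker (rdiff Q n) by rewrite -ex memv_img ?memvf.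
rewrite memv_ker => /eqP/(congr1 (pr n)); rewrite free_red_rdiff linear0.
by rewrite free_red_rdiff linearN opprK free_red_one.
Qed.

(** Cycles and boundaries of the reduced bar resolution are the preimages under
    the reduction map of those of the bar complex, by [free_red_rdiff]. *)
Lemma tor_eq0_bar n j : tor_eq0 A n.+1 j <-> bar_exact T del n j.
Proof.
have rQ := bar_projres adX.
split=> [[P rP /(tor_independent adX rP rQ)/subvP tor0] | /subvP ex].
  apply/subvP => w /memv_capP[wk wj].
  pose o : rmod Q n.+1 := one_tens A X dg (bar_gr k del n.+1) w.
  have /tor0 : o \in (tor_cycles A Q n.+1 :&: mgr (rmod Q n.+1) j)%VS.
    apply/memv_capP; split; last first.
      by have /graded_mapP := one_tens_graded adX (bar_gr k del n.+1); apply.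
    rewrite -memv_preim free_tens_rel memv_ker free_red_rdiff free_red_one.
    by move: wk; rewrite memv_ker => /eqP ->; rewrite oppr0.
  case/memv_addP => _ /memv_imgP[y _ ->] [t]; rewrite free_tens_rel memv_ker.
  move=> /eqP t0 oE; suff -> : w = - bar_map T n.+1 (pr n.+2 y).
    by rewrite memvN memv_img ?memvf.
  have -> : w = pr n.+1 o by rewrite free_red_one.
  rewrite -free_red_rdiff oE.
  by rewrite [LHS]linearD [X in _ + X]t0 addr0.
exists Q => //; apply/subvP => x /memv_capP[].
rewrite -memv_preim free_tens_rel memv_ker free_red_rdiff oppr_eq0 => xk xj.
have /ex/memv_imgP[y _ yE] : pr n.+1 x \in (lker (bar_map T n) :&: bar_gr k del n.+1 j)%VS.
  by apply/memv_capP; split; [rewrite memv_ker | apply: free_red_graded xj].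
pose o : rmod Q n.+2 := one_tens A X dg (bar_gr k del n.+2) (- y).
rewrite -[x](subrKC (rdiff Q n.+1 o)) memv_add ?memv_img ?memvf //.
have prB (u v : rmod Q n.+1) : pr n.+1 (u - v) = pr n.+1 u - pr n.+1 v.
  exact: linearB.
rewrite free_tens_rel memv_ker prB free_red_rdiff free_red_one.
by rewrite opprK yE linearN subrr.
Qed.

(** Tor_0 is k, placed in degree 0. *)
Lemma tor0_eq0 j : j != 0 -> tor_eq0 A 0 j.
Proof.
move=> j0; exists Q; first exact: bar_projres adX.
apply/subvP => x /memv_capP[_ xj]; apply: (subvP (addvSr _ _)).
rewrite free_tens_rel memv_ker; have := free_red_graded xj.
by rewrite deg0_gradingP (negPf j0).
Qed.

End TorBar.

(** * Exactness is an open condition *)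

Import passmx.

Section PolyFun.
Variables (k : fieldType) (W : vectType k).
Implicit Types F : W -> k.

Definition polyfun F : Prop :=
  exists p : {mpoly k[\dim {:W}]}, forall w, polyval p w = F w.

Lemma polyfun_ext F F' : F =1 F' -> polyfun F -> polyfun F'.
Proof. by move=> FF' [p pF]; exists p => w; rewrite pF. Qed.

Lemma polyfun_const c : polyfun (fun=> c).
Proof. by exists c%:MP => w; rewrite /polyval mevalC. Qed.

Lemma polyfunD F F' : polyfun F -> polyfun F' -> polyfun (fun w => F w + F' w).
Proof.
by move=> [p pF] [q qF]; exists (p + q) => w; rewrite -pF -qF /polyval mevalD.
Qed.

Lemma polyfunM F F' : polyfun F -> polyfun F' -> polyfun (fun w => F w * F' w).
Proof.
by move=> [p pF] [q qF]; exists (p * q) => w; rewrite -pF -qF /polyval mevalM.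
Qed.

Lemma polyfun_sum I (r : seq I) (F : I -> W -> k) :
  (forall i, polyfun (F i)) -> polyfun (fun w => \sum_(i <- r) F i w).
Proof.
move=> pF; elim: r => [|i r IHr].
  by apply: polyfun_ext (polyfun_const 0) => w; rewrite big_nil.
by apply: polyfun_ext (polyfunD (pF i) IHr) => w; rewrite big_cons.
Qed.

Lemma polyfun_prod I (r : seq I) (F : I -> W -> k) :
  (forall i, polyfun (F i)) -> polyfun (fun w => \prod_(i <- r) F i w).
Proof.
move=> pF; elim: r => [|i r IHr].
  by apply: polyfun_ext (polyfun_const 1) => w; rewrite big_nil.
by apply: polyfun_ext (polyfunM (pF i) IHr) => w; rewrite big_cons.
Qed.

Lemma polyfun_linear (l : 'Hom(W, k^o)) : polyfun (fun w => l w).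
Proof.
pose F w : k := \sum_(i < \dim {:W}) (l (vbasis {:W})`_i : k) * coord (vbasis {:W}) i w.
apply: (@polyfun_ext F) => [w|].
  rewrite {2}[w](coord_vbasis (memvf w)) linear_sum; apply: eq_bigr => i _.
  by rewrite linearZ /= [RHS]mulrC.
apply: polyfun_sum => i; apply: polyfunM; first exact: polyfun_const.
by exists 'X_i => w; rewrite /polyval mevalXU.
Qed.

Lemma polyfun_det n (M : W -> 'M[k]_n) :
  (forall i j, polyfun (fun w => M w i j)) -> polyfun (fun w => \det (M w)).
Proof.
move=> pM; apply: polyfun_sum => s; apply: polyfunM; first exact: polyfun_const.
exact: polyfun_prod.
Qed.

(** A map with values in a vector space is polynomial when its coordinates are;
    testing against all linear forms avoids the choice of a basis. *)
Definition polymap (U : vectType k) (F : W -> U) : Prop :=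
  forall l : 'Hom(U, k^o), polyfun (fun w => l (F w)).

Lemma polymap_ext (U : vectType k) (F F' : W -> U) :
  F =1 F' -> polymap F -> polymap F'.
Proof. by move=> FF' pF l; apply: polyfun_ext (pF l) => w; rewrite FF'. Qed.

Lemma polymap_const (U : vectType k) (u : U) : polymap (fun=> u).
Proof. by move=> l; apply: polyfun_const. Qed.

Lemma polymap_lin (U U' : vectType k) (L : U -> U') (F : W -> U) :
  linear L -> polymap F -> polymap (fun w => L (F w)).
Proof.
move=> linL pF l; apply: polyfun_ext (pF (l \o linfun L)%VF) => w.
by rewrite comp_lfunE linfun_linearE.
Qed.

Lemma polymapD (U : vectType k) (F F' : W -> U) :
  polymap F -> polymap F' -> polymap (fun w => F w + F' w).
Proof.
by move=> p p' l; apply: polyfun_ext (polyfunD (p l) (p' l)) => w; rewrite linearD.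
Qed.

Lemma polymapZ (U : vectType k) (c : W -> k) (F : W -> U) :
  polyfun c -> polymap F -> polymap (fun w => c w *: F w).
Proof.
by move=> pc pF l; apply: polyfun_ext (polyfunM pc (pF l)) => w; rewrite linearZ.
Qed.

Lemma polymapB (U : vectType k) (F F' : W -> U) :
  polymap F -> polymap F' -> polymap (fun w => F w - F' w).
Proof.
move=> p p'; apply: polymapD => //; apply: polymap_lin p' => c u v.
by rewrite opprD scalerN.
Qed.

Lemma polymap_sum (U : vectType k) I (r : seq I) (F : I -> W -> U) :
  (forall i, polymap (F i)) -> polymap (fun w => \sum_(i <- r) F i w).
Proof.
move=> pF; elim: r => [|i r IHr].
  by apply: polymap_ext (polymap_const 0) => w; rewrite big_nil.
by apply: polymap_ext (polymapD (pF i) IHr) => w; rewrite big_cons.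
Qed.

Lemma polymap_ffun (I : finType) (U : vectType k) (F : I -> W -> U) :
  (forall i, polymap (F i)) -> polymap (fun w => [ffun i => F i w]).
Proof.
move=> pF; apply: (@polymap_ext _ (fun w => \sum_i delta_ffun i (F i w))) => [w|].
  by rewrite [RHS]ffun_delta_sum; apply: eq_bigr => i _; rewrite ffunE.
by apply: polymap_sum => i; apply: polymap_lin (delta_ffun_linear _) _.
Qed.

Lemma polymap_det (U : vectType k) (E : W -> 'End(U)) :
  (forall u, polymap (fun w => E w u)) ->
  polyfun (fun w => \det (mxof (vbasis {:U}) (vbasis {:U}) (E w))).
Proof.
move=> pE; apply: polyfun_det => i j; pose e := vbasis {:U}.
have lc : linear (coord e j : U -> k^o) by move=> c u v; rewrite linearP.
apply: polyfun_ext (pE (e`_i) (linfun (coord e j : U -> k^o))) => w.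
by rewrite linfun_linearE // !mxE /= vecof_delta.
Qed.

End PolyFun.

Lemma det_mxof_lker (k : fieldType) (U : vectType k) (E : 'End(U)) :
  \det (mxof (vbasis {:U}) (vbasis {:U}) E) != 0 -> lker E = 0%VS.
Proof.
rewrite -unitfE -[_ \is a _]/(mxof _ _ E \in unitmx) => Eu.
apply/eqP; rewrite -subv0; apply/subvP => u; rewrite memv_ker memv0 => /eqP Eu0.
have eb := vbasisP {:U}; rewrite -(rVof_eq0 eb).
have E0 : rVof (vbasis {:U}) u *m mxof (vbasis {:U}) (vbasis {:U}) E = 0.
  by rewrite mul_mxof (rVofK eb) Eu0; apply/eqP; rewrite (rVof_eq0 eb).
by rewrite -[rVof _ u](mulmxK Eu) E0 mul0mx.
Qed.

Section Semicontinuity.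
Variables (k : fieldType) (W U Y Z : vectType k).
Variables (HU : grading U) (HY : grading Y) (HZ : grading Z).
Variables (d1 : W -> 'Hom(U, Y)) (d2 : W -> 'Hom(Z, U)).
Hypotheses (d1_poly : forall u, polymap (fun w => d1 w u)).
Hypotheses (d2_poly : forall z, polymap (fun w => d2 w z)).

(** At [w0], exactness gives [s1] and [s2] with [s1 d1 + d2 s2] the identity on
    the component of degree [j]. For other values of [w], with [s1] and [s2]
    unchanged, the same expression defines an endomorphism [E w], and [phi] is
    its determinant. On the kernel of [d1 w] in degree [j] only the second
    summand survives, so [E w] maps this kernel into the image of [d2 w] in
    degree [j]; when [E w] is injective the two have the same dimension. *)
Lemma exactness_open (j : int) (w0 : W) :
  graded_map HU HY (d1 w0) -> (lker (d1 w0) :&: HU j <= limg (d2 w0))%VS ->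
  exists2 phi : W -> k, polyfun phi & phi w0 != 0 /\
    forall w, graded_map HZ HU (d2 w) -> (forall z, d1 w (d2 w z) = 0) ->
      phi w != 0 -> (lker (d1 w) :&: HU j <= limg (d2 w))%VS.
Proof.
move=> g1 /subvP ex; pose pi := gproj HU j.
pose s1 := (pi \o (d1 w0)^-1)%VF.
pose s2 := ((d2 w0)^-1 \o (\1 - (s1 \o d1 w0)))%VF.
(* Adding [\1 - pi] makes [E w] the identity on the other components. *)
pose E w := (pi \o ((s1 \o d1 w) + (d2 w \o s2)) \o pi + (\1 - pi))%VF.
have EE w u : E w u = pi (s1 (d1 w (pi u)) + d2 w (s2 (pi u))) + (u - pi u).
  by rewrite !(add_lfunE, opp_lfunE, comp_lfunE, id_lfunE).
exists (fun w => \det (mxof (vbasis {:U}) (vbasis {:U}) (E w))).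
  apply: polymap_det => u; apply: (polymap_ext (fun w => esym (EE w u))).
  apply: polymapD (polymap_const _ _); apply: polymap_lin; first exact: linearP.
  apply: polymapD; last exact: d2_poly.
  by apply: polymap_lin; [exact: linearP | exact: d1_poly].
split=> [|w g2 d12 /det_mxof_lker Einj].
  suff -> : E w0 = \1%VF by rewrite mxof1 ?det1 ?oner_eq0 ?(basis_free (vbasisP _)).
  apply/lfunP => u; rewrite EE id_lfunE; set z := pi u.
  have zj : z \in HU j by apply: gproj_mem.
  have s1z : s1 (d1 w0 z) \in HU j by rewrite comp_lfunE gproj_mem.
  have /ex/limg_lfunVK z2 : z - s1 (d1 w0 z) \in (lker (d1 w0) :&: HU j)%VS.
    apply/memv_capP; split; last exact: memvB.
    rewrite memv_ker linearB /= comp_lfunE.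
    rewrite (graded_gproj g1 j ((d1 w0)^-1%VF _)) limg_lfunVK ?memv_img ?memvf //.
    by rewrite -(graded_gproj g1) (gproj_id zj) subrr.
  rewrite [s2 z]comp_lfunE add_lfunE opp_lfunE id_lfunE [(_ \o _)%VF z]comp_lfunE.
  by rewrite z2 [s1 _ + _]addrC subrK gproj_id // addrC subrK.
pose K := (lker (d1 w) :&: HU j)%VS; pose I := (limg (d2 w) :&: HU j)%VS.
have IK : (I <= K)%VS.
  apply/subvP => _ /memv_capP[/memv_imgP[z _ ->] zj].
  by rewrite memv_cap zj memv_ker d12 eqxx.
have EK : (E w @: K <= I)%VS.
  apply/subvP => _ /memv_imgP[z /memv_capP[zk zj] ->].
  move: zk; rewrite memv_ker => /eqP zk.
  rewrite EE [pi z]gproj_id // zk subrr addr0 linear0 add0r memv_cap gproj_mem.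
  by rewrite andbT -(graded_gproj g2) memv_img ?memvf.
have : I == K.
  rewrite eqEdim IK -(@limg_dim_eq _ _ _ (E w) K) ?Einj ?capv0 //.
  exact: dimvS.
by move/eqP => KI; rewrite -/K -KI capvSl.
Qed.

End Semicontinuity.

Section BarPoly.
Variables (k : fieldType) (W : vectType k) (d : nat).
Variable T : W -> 'I_d -> 'I_d -> 'I_d -> k.
Hypothesis T_poly : forall a b c, polyfun (fun w => T w a b c).

Lemma bar_op_poly n a (g : W -> barW k d n) :
  polymap g -> polymap (fun w => bar_op (T w) a (g w)).
Proof.
elim: n a g => [|n IHn] a g pg; first exact: polymap_const.
have pgb b : polymap (fun w => (g w : {ffun 'I_d -> barW k d n}) b).
  exact: (polymap_lin (L := fun f : {ffun 'I_d -> barW k d n} => f b)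
    (ev_linear b) pg).
apply: polymap_ffun => c; apply: polymapB.
  by apply: polymap_sum => b; apply: polymapZ.
case: eqP => _; last exact: polymap_const.
by apply: polymap_sum => b; apply: IHn.
Qed.

(** The entries of the bar differential are obtained from the structure
    constants by sums and products only. *)
Lemma bar_map_poly n g : polymap (fun w => bar_map (T w) n g).
Proof.
apply: (@polymap_ext _ _ _ (fun w => bar_diff (T w) g)) => [w|].
  by rewrite bar_mapE.
by apply: polymap_sum => b; apply: bar_op_poly; apply: polymap_const.
Qed.

End BarPoly.

Lemma eq_bar_map (k : fieldType) d (T T' : 'I_d -> 'I_d -> 'I_d -> k) n :
  (forall a b c, T a b c = T' a b c) -> bar_map T n = bar_map T' n.
Proof.
move=> TT'; suff E m a (g : barW k d m) : bar_op T a g = bar_op T' a g.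
  by apply/lfunP => g; rewrite !bar_mapE; apply: eq_bigr => b _; exact: E.
elim: m a g => [|m IHm] a g //=; apply/ffunP => c; rewrite !ffunE.
congr (_ - _); first by apply: eq_bigr => b _; rewrite TT'.
by case: ifP => // _; apply: eq_bigr => b _; apply: IHm.
Qed.

(** * Connectedness, orbits and generation in degree one *)

Section AdaptedExists.
Variables (k : fieldType) (V : vectType k) (G : grading V).

Definition ext_deg d (del : 'I_d -> int) (i : 'I_d.+1) : int :=
  if unlift ord0 i is Some b then del b else 0.

(** A free family in the augmentation ideal stays free when the unit is added,
    and then the dimension makes it a basis. *)
Lemma adapted_cons (A : gralg G) d (s : d.-tuple V) (del : 'I_d -> int) :
  gone A != 0 -> \dim {:V} = d.+1 -> free s ->
  (forall b, tnth s b \in G (del b)) -> (forall b, 1 <= del b) ->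
  adapted_basis A [tuple of gone A :: s] (ext_deg del).
Proof.
move=> A0 dimV fs sG del1; split.
- rewrite basisEfree subvf dimV /= size_tuple leqnn !andbT free_cons fs andbT.
  apply: contra A0 => sA; rewrite -memv0 -(augideal_disjoint A).
  rewrite memv_cap memv_line /=; move: (gone A) sA; apply/subvP/span_subvP => v.
  by case/tnthP => b ->; apply: augideal_sup (del1 b) (sG b).
- by rewrite (tnth_nth 0).
- move=> b; rewrite /ext_deg; case: (unliftP ord0 b) => [c ->|->].
    by rewrite tnthS sG.
  by rewrite tnth0 gone_homog.
- by move=> b; rewrite /ext_deg liftK.
Qed.

Lemma augideal_sum x : x \in augideal G ->
  exists n (u : 'I_n -> V) (e : 'I_n -> int),
    [/\ forall i, u i \in G (e i), forall i, 1 <= e i & x = \sum_i u i].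
Proof.
rewrite /augideal -big_filter big_tnth => /memv_sumP[u uG ->].
exists _, u, (tnth (in_tuple [seq i <- gsupp G | 1 <= i])); split=> // i.
  exact: uG.
have := mem_tnth i (in_tuple [seq i <- gsupp G | 1 <= i]).
by rewrite mem_filter => /andP[].
Qed.

Lemma augideal_mul (A : gralg G) x y :
  x \in augideal G -> y \in augideal G -> gmul A x y \in augideal G.
Proof.
move=> /augideal_sum[n [u [e [uG e1 ->]]]] /augideal_sum[m [v [f [vG f1 ->]]]].
rewrite linear_sum memv_suml //= => j _; rewrite (linear_sum (gmul A)) sum_lfunE.
rewrite memv_suml // => i _; apply: augideal_sup (gmul_homog A (uG i) (vG j)).
by rewrite (le_trans (e1 i)) // lerDl (le_trans _ (f1 j)).
Qed.

(** The left hand side is a subalgebra that contains the component of degree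
    1. *)
Lemma connected_of_generated (A : gralg G) : generated_in_degree1 A ->
  (<[gone A]> + augideal G)%VS = fullv.
Proof.
set S := (_ + _)%VS.
have JS x : x \in augideal G -> x \in S by apply/subvP/addvSr.
have S1 : gone A \in S by rewrite (subvP (addvSl _ _)) ?memv_line.
apply=> //; first by apply/subvP => x /(augideal_sup (lexx _)); apply: JS.
move=> _ _ /memv_addP[_ /vlineP[a ->] [x xJ ->]] /memv_addP[_ /vlineP[b ->] [y yJ ->]].
rewrite (linearD (gmul A)) add_lfunE linearZ /= scale_lfunE gmul1x.
rewrite [gmul A x _]linearD linearZ /= gmulx1.
apply: memvD; first by rewrite memvZ // memvD ?memvZ // JS.
by rewrite memvD ?memvZ // JS // augideal_mul.
Qed.

Lemma adapted_exists (A : gralg G) : gone A != 0 -> generated_in_degree1 A ->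
  exists d (s : d.-tuple V) (del : 'I_d -> int),
  [/\ \dim {:V} = d.+1, free s, forall b, tnth s b \in G (del b)
    & forall b, 1 <= del b].
Proof.
move=> A0 /connected_of_generated full.
pose r := [seq i <- gsupp G | 1 <= i].
pose s := flatten [seq vbasis (G i) : seq V | i <- r].
have sJ : <<s>>%VS = augideal G.
  rewrite /s /augideal -big_filter -/r; elim: (r) => [|i r' IHr] /=.
    by rewrite span_nil big_nil.
  by rewrite span_cat IHr big_cons (span_basis (vbasisP _)).
have fs : free s.
  rewrite /free sJ /augideal -big_filter -/r.
  have /directvP/= -> : directv (\sum_(i <- r) G i).
    apply: (directv_projections (pi := fun i => gproj G i)).
    - by move=> i; apply: linearP.
    - by move=> i u; apply: gproj_id.
    - by move=> i j u; apply: gproj_out.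
    - exact/filter_uniq/gsupp_uniq.
  rewrite /s size_flatten /shape -map_comp sumnE big_map.
  by apply/eqP/eq_bigr => i _; rewrite /= size_tuple.
have sd (b : 'I_(size s)) : exists i : int, (1 <= i) && (tnth (in_tuple s) b \in G i).
  have /flattenP[_ /mapP[i ir ->] bi] := mem_tnth b (in_tuple s).
  exists i; rewrite (vbasis_mem bi) andbT.
  by move: ir; rewrite mem_filter => /andP[].
exists (size s), (in_tuple s), (fun b => xchoose (sd b)); split=> //.
- rewrite -full dimv_disjoint_sum ?augideal_disjoint // dim_vline A0.
  by rewrite -sJ (eqP fs).
- by move=> b; have /andP[] := xchooseP (sd b).
- by move=> b; have /andP[] := xchooseP (sd b).
Qed.

End AdaptedExists.

Section Orbit.
Variables (k : fieldType) (V : vectType k) (G : grading V).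
Implicit Types A B : gralg G.

(** An injective endomorphism that preserves a finite dimensional subspace maps
    it onto itself. *)
Lemma GL0_inv (g : 'End(V)) : GL0 G g -> forall i x, x \in G i -> g^-1%VF x \in G i.
Proof.
case=> ker gG i x xi; have gi : (g @: G i)%VS = G i.
  by apply/eqP; rewrite eqEdim gG limg_dim_eq ?ker ?capv0 /=.
move: xi; rewrite -gi => /memv_imgP[y yi ->].
by rewrite lker0_lfunK ?ker // gi.
Qed.

Lemma gorbit_grAss A m : gorbit G (gmul A) m -> grAss G m.
Proof.
case=> g gGL mE; have [ker gG] := gGL; split=> [x y z|i j x y xi yj].
  by rewrite !mE !lker0_lfunK ?ker // gmulA.
rewrite mE; apply: (subvP (gG _)); apply: memv_img.
by apply: gmul_homog; apply: GL0_inv.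
Qed.

Lemma gorbit_refl A : gorbit G (gmul A) (gmul A).
Proof.
have i1 : lker (\1%VF : 'End(V)) = 0%VS.
  by apply/eqP/lker0P => x y; rewrite !id_lfunE.
exists \1%VF => [|x y].
  by split=> // i; rewrite lim1g.
have V1 z : (\1%VF : 'End(V))^-1%VF z = z.
  by rewrite -[RHS](lker0_lfunK (f := \1%VF : 'End(V))) ?i1 // id_lfunE.
by rewrite id_lfunE !V1.
Qed.

(** The zeros of a polynomial are closed, so a polynomial function vanishing on
    the orbit of [A] vanishes on its closure. *)
Lemma degeneration_polyfun A B (phi : prodOn V -> k) :
  graded_degeneration A B -> polyfun phi ->
  (forall m, gorbit G (gmul A) m -> phi m = 0) -> phi (gmul B) = 0.
Proof.
move=> AB [p pphi] phi0.
pose Z m := grAss G m /\ polyval p m = 0.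
have [] : Z (gmul B); last by rewrite pphi.
apply: (AB _ (gorbit_refl B)).
  exists (eq p) => m; split=> [[mG pm] | [mG pm]]; split=> //.
    by move=> _ <-.
  exact: pm.
by move=> m Am; split; [apply: gorbit_grAss Am | rewrite pphi phi0].
Qed.

Variables (A : gralg G) (d : nat) (s : d.-tuple V) (del : 'I_d -> int).
Hypotheses (A0 : gone A != 0) (dimV : \dim {:V} = d.+1) (fs : free s).
Hypotheses (sG : forall b, tnth s b \in G (del b)) (del1 : forall b, 1 <= del b).

Definition transport_tuple (g : 'End(V)) : d.-tuple V := map_tuple (g^-1)%VF s.

Lemma transport_adapted g : GL0 G g ->
  adapted_basis A [tuple of gone A :: transport_tuple g] (ext_deg del).
Proof.
move=> gGL; have [ker gG] := gGL; apply: adapted_cons => //.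
  rewrite /free -limg_span limg_dim_eq ?size_map ?(eqP fs) //.
  apply/eqP; rewrite -subv0; apply/subvP => x /memv_capP[_].
  rewrite memv_ker memv0 => /eqP gx0.
  by rewrite -[x](lker0_lfunVK (f := g)) ?ker // gx0 linear0.
by move=> b; rewrite tnth_map; apply: GL0_inv.
Qed.

(** The map [g] is an isomorphism from [A] to the algebra with product [m] that
    carries the basis [g^-1 s] to [s]. The units need not correspond, as [m] and
    [B] can have different units, but products of elements of positive degree
    have no component along them. *)
Lemma transport_struct_const B (m : prodOn V) g : GL0 G g ->
  (forall x y, m x y = g (gmul A (g^-1%VF x) (g^-1%VF y))) ->
  adapted_basis B [tuple of gone B :: s] (ext_deg del) ->
  forall a b c, coord [tuple of gone B :: s] (lift ord0 c) (m (tnth s a) (tnth s b))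
    = struct_const A [tuple of gone A :: transport_tuple g] a b c.
Proof.
move=> gGL mE adB a b c; have adA := transport_adapted gGL.
have [ker gG] := gGL.
set XA := [tuple of _ :: _] in adA *; set XB := [tuple of _ :: _] in adB *.
have xA e : tnth XA (lift ord0 e) = (g^-1)%VF (tnth s e).
  by rewrite tnthS tnth_map.
have xB e : tnth XB (lift ord0 e) = tnth s e by rewrite tnthS.
rewrite mE -!xA [gmul _ _ _](coord_adapted adA) big_ord_recl.
rewrite -(augmE adA) (augmM adA) (augm_homog adA (adb_homog adA _)); last first.
  by rewrite gt_eqF // (lt_le_trans ltr01) ?(adb_pos adA).
rewrite mul0r scale0r add0r linear_sum.
pose f i := if unlift ord0 i is Some e then struct_const A XA a b e else 0.
rewrite (_ : \sum_i _ = \sum_i f i *: tnth XB i).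
  by rewrite (coord_adapted_sum adB) /f liftK.
rewrite [RHS]big_ord_recl /f unlift_none scale0r add0r; apply: eq_bigr => e _.
by rewrite liftK linearZ /= (xA e) xB lker0_lfunVK ?ker.
Qed.

End Orbit.

Section Generation.
Variables (k : fieldType) (V : vectType k) (G : grading V) (A : gralg G).
Variables (d : nat) (X : d.+1.-tuple V) (dg : 'I_d.+1 -> int).
Hypothesis adX : adapted_basis A X dg.
Local Notation x1_ b := (tnth X (lift ord0 b)).
Local Notation del := (fun b : 'I_d => dg (lift ord0 b)).
Local Notation T := (struct_const A X).

Lemma mul_struct_const a b : gmul A (x1_ a) (x1_ b) = \sum_c T a b c *: x1_ c.
Proof.
rewrite {1}[gmul _ _ _](coord_adapted adX) big_ord_recl.
rewrite -(augmE adX) (augmM adX) (augm_homog adX (adb_homog adX _)); last first.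
  by rewrite gt_eqF // (lt_le_trans ltr01) ?(adb_pos adX).
by rewrite mul0r scale0r add0r.
Qed.

(** Exactness at J says that every basis element of degree other than 1 is a
    combination of products of basis elements of J. Taking the component of the
    right degree, the factors have smaller degree, and induction applies. *)
Lemma generated_of_bar_exact :
  (forall j : nat, j <> 1%N -> bar_exact T del 0 j%:Z) -> generated_in_degree1 A.
Proof.
move=> ex U U1 UG1 Umul; apply/eqP; rewrite eqEsubv subvf; apply/subvP => v _.
rewrite [v](coord_adapted adX) memv_suml // => i _; rewrite memvZ //.
case: (unliftP ord0 i) => [b ->|->]; last by rewrite (adb_one adX).
have [n le_n] := ubnP `|del b|%N; elim: n b le_n {v i} => // n IHn b le_n.
have pos a : (0 < `|del a|)%N /\ del a = `|del a|%:Z.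
  have := adb_pos adX a; rewrite /=; case: (dg _) => // m h; split=> //.
have [j1|/eqP j1] := eqVneq (`|del b|%N) 1%N.
  by rewrite (subvP UG1) // -[1](_ : del b = 1) ?(adb_homog adX) // (pos b).2 j1.
have /subvP exb := ex _ j1; set j := `|del b|%N in j1 exb.
pose e : barW k d 1 := delta_ffun (W := k^o) b 1.
have ej : e \in bar_gr k del 1 j%:Z.
  apply/ffun_compP => c; rewrite ffunE; case: eqP => [->|_]; last exact: mem0v.
  by rewrite deg0_gradingP (pos b).2 subrr.
have /exb/memv_imgP[g0 _ g0E] : e \in (lker (bar_map T 0) :&: bar_gr k del 1 j%:Z)%VS.
  by rewrite memv_cap ej andbT memv_ker bar_mapE /bar_diff big1.
(* The preimage [g0] need not be homogeneous. *)
pose g : {ffun 'I_d -> {ffun 'I_d -> k^o}} := gproj (bar_gr k del 2) j%:Z g0.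
have gE : e = bar_map T 1 g.
  by rewrite (graded_gproj (bar_map_graded adX 1)) -g0E gproj_id.
have gdeg a c : g a c != 0 -> (`|del a| + `|del c| = j)%N.
  have /ffun_compP/(_ a)/ffun_compP/(_ c) := gproj_mem (bar_gr k del 2) j%:Z g0.
  rewrite -/(g a c) deg0_gradingP => /orP[|->//].
  rewrite -addrA -opprD subr_eq0 (pos a).2 (pos c).2 => /eqP h _.
  by apply/eqP; rewrite -eqz_nat PoszD -h.
(* the isomorphism of the first syzygy of k with J *)
pose tau (h : {ffun 'I_d -> k^o}) : V := \sum_c (h c : k) *: x1_ c.
have tauE : x1_ b = \sum_a \sum_c (g a c : k) *: gmul A (x1_ a) (x1_ c).
  transitivity (tau e).
    rewrite /tau (bigD1 b) //= ffunE eqxx scale1r big1 ?addr0 // => c /negPf cb.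
    by rewrite ffunE cb scale0r.
  rewrite gE bar_mapE /bar_diff /tau.
  under eq_bigr => c _ do rewrite sum_ffunE scaler_suml.
  rewrite exchange_big; apply: eq_bigr => a _ /=.
  under [RHS]eq_bigr => c _ do rewrite mul_struct_const scaler_sumr.
  rewrite exchange_big; apply: eq_bigr => c _ /=.
  rewrite ffunE big1_eq if_same subr0 scaler_suml; apply: eq_bigr => h _.
  by rewrite scalerA mulrC.
rewrite tauE memv_suml // => a _; rewrite memv_suml // => c _.
have [->|/gdeg acj] := eqVneq (g a c) 0; first by rewrite scale0r mem0v.
have [pa pc] := ((pos a).1, (pos c).1).
rewrite memvZ // Umul // IHn //; apply: leq_trans (ltnSE le_n).
  by rewrite -/j -acj -[X in (X < _)%N]addn0 ltn_add2l.
by rewrite -/j -acj -[X in (X < _)%N]add0n ltn_add2r.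
Qed.

End Generation.

Theorem proposition4p5 (k : closedFieldType) (N : nat) (hN : (2 <= N)%N)
    (V : vectType k) (G : grading V) (A B : gralg G)
    (hdeg : graded_degeneration A B) (hB : koszul N B) :
  koszul N A.
Proof.
have [B0 genB torB] := hB.
have A0 : gone A != 0.
  by apply: contra_neq B0 => A0; rewrite -(gmul1x A (gone B)) A0 linear0 lfunE.
have [d [s [del [dimV fs sG del1]]]] := adapted_exists B0 genB.
have adB := adapted_cons B0 dimV fs sG del1.
have adA := adapted_cons A0 dimV fs sG del1.
set XA := [tuple of gone A :: s] in adA; set XB := [tuple of gone B :: s] in adB.
set dg := ext_deg del in adA adB.
pose del' (b : 'I_d) := dg (lift ord0 b).
pose T (m : prodOn V) a b c := coord XB (lift ord0 c) (m (tnth s a) (tnth s b)).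
have exB n j : tor_eq0 B n.+1 j -> bar_exact (struct_const A XA) del' n j.
  move/(tor_eq0_bar adB) => exB; apply/negPn/negP => nexA.
  have TB n' : bar_map (struct_const B XB) n' = bar_map (T (gmul B)) n'.
    by apply: eq_bar_map => a b c; rewrite /struct_const !tnthS.
  have Tpoly a b c : polyfun (fun m => T m a b c).
    pose l (m : prodOn V) : k^o := coord XB (lift ord0 c) (m (tnth s a) (tnth s b)).
    have ll : linear l.
      by move=> x u v; rewrite /l add_lfunE scale_lfunE add_lfunE scale_lfunE linearP.
    by apply: polyfun_ext (polyfun_linear (linfun l)) => m; rewrite linfun_linearE.
  have pmap n' := bar_map_poly Tpoly (n := n').
  have [||phi pphi [phiB phiP]] := exactness_open (HU := bar_gr k del' n.+1)
    (HY := bar_gr k del' n) (bar_gr k del' n.+2) (pmap n) (pmap n.+1) (w0 := gmul B) (j := j).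
  - by rewrite -TB; apply: bar_map_graded adB n.
  - by rewrite -!TB.
  (* If the bar complex of [A] were not exact here, [phi] would vanish on its
     orbit, as exactness, being the vanishing of Tor, does not depend on the
     adapted basis. *)
  move/negP: phiB; apply; apply/eqP; apply: (degeneration_polyfun hdeg pphi).
  move=> m [g gGL mE]; apply/eqP; apply: contraNT nexA => phim.
  have adg := transport_adapted A0 dimV fs sG del1 gGL.
  set Xg := [tuple of _ :: _] in adg.
  have Tg n' : bar_map (struct_const A Xg) n' = bar_map (T m) n'.
    apply: eq_bar_map => a b c; apply/esym.
    by have := transport_struct_const A0 dimV fs sG del1 gGL mE adB a b c.
  (* Tor of [A] computed in the basis transported by [g]. *)
  apply/(tor_eq0_bar adA)/(tor_eq0_bar adg); rewrite /bar_exact !Tg.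
  apply: phiP => //; first by rewrite -Tg; apply: bar_map_graded adg n.+1.
  by move=> z; rewrite -!Tg; apply: bar_map_comp adg n z.
split=> //.
- apply: (generated_of_bar_exact adA) => j j1; apply: exB; apply: torB.
  by rewrite /koszul_deg.
- move=> [|n] j jN; last by apply/(tor_eq0_bar adA); apply: exB; apply: torB.
  apply: (tor0_eq0 adA).
  by apply/eqP => -[j0]; apply: jN; rewrite j0.
Qed.
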